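(* Let $0<\beta\le n$, $\alpha\in[0,\beta)$, and let $Q_0\subset\mathbb{R}^n$ be a finite open cube. Let $f\in\mathrm{VMO}^\beta(Q_0)$ with $\operatorname{supp} f\subset Q_0$. If $\mathcal{M}_\alpha f$ is not identically infinite, then $\mathcal{M}_\alpha f\in\mathrm{VMO}^\beta(Q_0)$.
   Context: All cubes are open with sides parallel to the coordinate axes; $\ell(Q)$ is the side length of $Q$. A function with $\operatorname{supp} f\subset Q_0$ is regarded as a function on $\mathbb{R}^n$ vanishing outside $Q_0$. $\mathcal{M}_\alpha f(x)=\sup_{Q\ni x}\ell(Q)^{-(n-\alpha)}\int_Q|f(y)|\,dy$ (Lebesgue integral), supremum over all open cubes $Q\subset\mathbb{R}^n$ containing $x$. Dyadic Hausdorff content: with $\mathcal{D}_0=\{2^k(l+[0,1)^n):k\in\mathbb{Z},\,l\in\mathbb{Z}^n\}$, for $E\subset\mathbb{R}^n$, $\mathcal{H}_\infty^\beta(E)=\inf\{\sum_{i=1}^\infty\ell(Q_i)^\beta: E\subset\bigcup_i Q_i,\ Q_i\in\mathcal{D}_0\}$. For $f:\Omega\to[0,\infty]$, $\int_\Omega f\,d\mathcal{H}_\infty^\beta=\int_0^\infty\mathcal{H}_\infty^\beta(\{x\in\Omega:f(x)>t\})\,dt$. For $\Omega$ open, $f:\Omega\to\mathbb{R}$ is $\mathcal{H}_\infty^\beta$-quasicontinuous on $\Omega$ if for every $\epsilon>0$ there is an open set $O_\epsilon\subset\Omega$ with $\mathcal{H}_\infty^\beta(O_\epsilon)<\epsilon$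 and $f|_{\Omega\setminus O_\epsilon}$ continuous. $L^1(\mathcal{H}_\infty^\beta,\Omega)$ is the set of $\mathcal{H}_\infty^\beta$-quasicontinuous $f$ on $\Omega$ with $\int_\Omega|f|\,d\mathcal{H}_\infty^\beta<\infty$. For a cube $Q\subset Q_0$ put $\mathcal{O}_\beta(f,Q)=\inf_{c\in\mathbb{R}}\frac{1}{\mathcal{H}_\infty^\beta(Q)}\int_Q|f-c|\,d\mathcal{H}_\infty^\beta$, and for $r>0$ put $\omega_\beta(f,r)=\sup_{Q\subset Q_0,\ \ell(Q)\le r}\mathcal{O}_\beta(f,Q)$. $\mathrm{BMO}^\beta(Q_0)$ is the set of $f\in L^1(\mathcal{H}_\infty^\beta,Q_0)$ with $\|f\|_{\mathrm{BMO}^\beta(Q_0)}=\sup_Q\mathcal{O}_\beta(f,Q)<\infty$, supremum over finite subcubes $Q$ of $Q_0$ parallel to $Q_0$. $\mathrm{VMO}^\beta(Q_0)$ is the set of $f\in\mathrm{BMO}^\beta(Q_0)$ with $\lim_{r\to0^+}\omega_\beta(f,r)=0$. *)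

(* Defs.v *)
From HB Require Import structures.
From mathcomp Require Import all_boot all_order all_algebra.
From mathcomp Require Import all_classical all_reals all_analysis.

Set Implicit Arguments.
Unset Strict Implicit.
Unset Printing Implicit Defensive.

Import Order.TTheory GRing.Theory Num.Theory.
Import numFieldNormedType.Exports.

Local Open Scope classical_set_scope.
Local Open Scope ring_scope.

Section countable_covers.
Local Open Scope ereal_scope.
Context {R : realType} {T I : Type}.
Variables (S : I -> set T) (v : I -> R).

Definition cover_content (E : set T) : \bar R :=
  ereal_inf [set \sum_(0 <= k <oo) (v (i k))%:E |
             i in [set i : nat -> I | E `<=` \bigcup_k S (i k)]].

Hypothesis v_ge0 : forall i, (0 <= v i)%R.

Lemma cover_content_ge0 E : 0 <= cover_content E.
Proof.
by apply: le_ereal_inf_tmp => _ /= [i _ <-]; apply: nneseries_ge0 => k _ _;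
  rewrite lee_fin.
Qed.

Lemma cover_content_set0 i0 : v i0 = 0%R -> cover_content set0 = 0.
Proof.
move=> vi0; apply/eqP; rewrite eq_le cover_content_ge0 andbT.
apply: ereal_inf_lbound; exists (fun=> i0) => //=.
by rewrite vi0 eseries0.
Qed.

Lemma le_cover_content : {homo cover_content : A B / A `<=` B >-> A <= B}.
Proof.
move=> A B AB; apply: le_ereal_inf_tmp => _ /= [i Bi <-].
by apply: ereal_inf_lbound; exists i => //=; exact: subset_trans Bi.
Qed.

Lemma cover_content_sigma_subadditive : sigma_subadditive cover_content.
Proof.
move=> A; have [[i ioo]|] := pselect (exists i, cover_content (A i) = +oo).
  rewrite (eseries_pinfty _ _ ioo) ?leey// => n _.
  by rewrite -ltNye (lt_le_trans _ (cover_content_ge0 _)).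
rewrite -forallNE => Aoo.
suff add2e (e : {posnum R}) : cover_content (\bigcup_n A n) <=
    \sum_(i <oo) cover_content (A i) + e%:num%:E.
  by apply/lee_addgt0Pr => _/posnumP[].
rewrite (le_trans _ (epsilon_trick _ _ _))//; last first.
  by move=> n; exact: cover_content_ge0.
pose P n (c : nat -> I) := A n `<=` \bigcup_k S (c k) /\
  \sum_(k <oo) (v (c k))%:E <=
    cover_content (A n) + (e%:num / (2 ^ n.+1)%:R)%:E.
have [G PG] : {G : nat -> nat -> I & forall n, P n (G n)}.
  apply: (@choice _ _ P) => n.
  have en1 : (0 < e%:num / (2 ^ n.+1)%:R :> R)%R by [].
  have fA : cover_content (A n) \is a fin_num.
    by rewrite ge0_fin_numE ?cover_content_ge0// ltey; apply/eqP/Aoo.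
  have [_ [c Ac <-] cS] := lb_ereal_inf_adherent en1 fA.
  by exists c; split => //; exact/ltW.
have vG_ge0 x : 0 <= (v (uncurry G x))%:E by rewrite lee_fin.
apply: (@le_trans _ _ (\esum_(x in [set: nat * nat]) (v (uncurry G x))%:E)).
  have /card_esym/ppcard_eqP[f] := card_nat2.
  have bf : set_bij [set: nat] [set: nat * nat] f by exact: bij.
  rewrite (reindex_esum _ _ _ _ bf).
  rewrite -nneseries_esumT//.
  apply: ereal_inf_lbound; exists (uncurry G \o f) => //= t.
  move=> [n _ /(PG n).1[k _ tk]].
  by exists (f^-1%FUN (n, k)) => //=; rewrite invK ?inE.
have -> : \esum_(x in [set: nat * nat]) (v (uncurry G x))%:E =
    \sum_(n <oo) \sum_(k <oo) (v (G n k))%:E.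
  rewrite nneseries_esumT => [|n]; last first.
    by apply: nneseries_ge0 => k _ _; rewrite lee_fin.
  under [RHS]eq_esum => n _.
    rewrite nneseries_esumT; last by move=> k; rewrite lee_fin.
    over.
  rewrite esum_esum => [|n k _ _]; last by rewrite lee_fin.
  by congr esum; [apply/seteqP; split | apply/funext => -[]].
apply: lee_lim => //.
- apply: is_cvg_nneseries => n _ _; apply: nneseries_ge0 => m _ _.
  exact: (vG_ge0 (n, m)).
- by apply: is_cvg_nneseries => n _ _; apply: adde_ge0 => //;
    exact: cover_content_ge0.
- by near=> n; apply: lee_sum => i _; exact: (PG i).2.
Unshelve. all: by end_near. Qed.

End countable_covers.

(* The ambient space is R^n.+1, i.e. 'rV[R]_n.+1, so that the dimension is
   at least 1. *)
Section lebesgue.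
Context {R : realType} {n : nat}.
Implicit Types a b : 'rV[R]_n.+1.

Definition box (ab : 'rV[R]_n.+1 * 'rV[R]_n.+1) : set 'rV[R]_n.+1 :=
  [set x | forall i, ab.1 0 i <= x 0 i < ab.2 0 i].

Definition box_volume (ab : 'rV[R]_n.+1 * 'rV[R]_n.+1) : R :=
  \prod_i Num.max 0 (ab.2 0 i - ab.1 0 i).

Definition lebesgue_outer : set 'rV[R]_n.+1 -> \bar R :=
  cover_content box box_volume.

Lemma box_volume_ge0 ab : 0 <= box_volume ab.
Proof. by apply: prodr_ge0 => i _; rewrite le_max lexx. Qed.

Lemma box_volume00 : box_volume (0, 0) = 0.
Proof. by rewrite /box_volume big_ord_recl /= subrr maxxx mul0r. Qed.

HB.instance Definition _ := isOuterMeasure.Build R 'rV[R]_n.+1 lebesgue_outer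
  (cover_content_set0 box box_volume_ge0 box_volume00)
  (cover_content_ge0 box box_volume_ge0)
  (@le_cover_content _ _ _ box box_volume)
  (cover_content_sigma_subadditive box box_volume_ge0).

Definition lebesgue_outer_measure :
    {outer_measure set 'rV[R]_n.+1 -> \bar R} := lebesgue_outer.

(* Lebesgue measure, on the (complete) sigma-algebra of
   Caratheodory-measurable sets. *)
Definition lebesgueRn :
    {measure set (caratheodory_type lebesgue_outer_measure) -> \bar R} :=
  lebesgue_outer_measure.

End lebesgue.

Section hausdorff_content.
Context {R : realType} {n : nat}.
Local Open Scope ereal_scope.
Implicit Types (E : set 'rV[R]_n.+1) (f : 'rV[R]_n.+1 -> \bar R).

(* The index (k, l) encodes 2^k (l + [0, 1)^n). *)
Definition dyadic_cube (kl : int * 'rV[int]_n.+1) : set 'rV[R]_n.+1 :=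
  [set x | forall i, (2 ^ kl.1 * (kl.2 0%R i)%:~R <= x 0%R i
                      < 2 ^ kl.1 * ((kl.2 0%R i)%:~R + 1))%R].

Definition hcontent (beta : R) : set 'rV[R]_n.+1 -> \bar R :=
  cover_content dyadic_cube (fun kl => (2 ^ kl.1) `^ beta)%R.

Definition choquet (beta : R) E f : \bar R :=
  \int[lebesgue_measure]_(t in `[0%R, +oo[)
    hcontent beta [set x | E x /\ t%:E < f x].

End hausdorff_content.

Section oscillation.
Context {R : realType} {n : nat}.
Local Open Scope ereal_scope.
Implicit Types (E Q : set 'rV[R]_n.+1) (f : 'rV[R]_n.+1 -> \bar R).

Definition cube (a : 'rV[R]_n.+1) (r : R) : set 'rV[R]_n.+1 :=
  [set x | forall i, (a 0 i < x 0 i < a 0 i + r)%R].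

(* A maximal function may take the value +oo, so the notions below are stated
   for extended-real-valued functions; a quasicontinuous function has to be
   real-valued off the exceptional open set. *)
Definition quasicontinuous (beta : R) E f : Prop :=
  forall e : R, (0 < e)%R -> exists O : set 'rV[R]_n.+1,
    [/\ open O, O `<=` E, hcontent beta O < e%:E,
        {in E `\` O, forall x, f x \is a fin_num} &
        {within E `\` O, continuous f}].

Definition L1_hcontent (beta : R) E f : Prop :=
  quasicontinuous beta E f /\ choquet beta E (fun x => `|f x|) < +oo.

Definition mean_osc (beta : R) f Q : \bar R :=
  ereal_inf [set (hcontent beta Q)^-1 * choquet beta Q (fun x => `|f x - c%:E|)
            | c in [set: R]].

Definition osc_modulus (beta : R) Q0 f (r : R) : \bar R :=
  ereal_sup [set s | exists (a : 'rV[R]_n.+1) (l : R),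
    [/\ (0 < l)%R, (l <= r)%R, cube a l `<=` Q0 &
        s = mean_osc beta f (cube a l)]].

Definition bmo_norm (beta : R) Q0 f : \bar R :=
  ereal_sup [set s | exists (a : 'rV[R]_n.+1) (l : R),
    [/\ (0 < l)%R, cube a l `<=` Q0 & s = mean_osc beta f (cube a l)]].

Definition BMO (beta : R) Q0 f : Prop :=
  L1_hcontent beta Q0 f /\ bmo_norm beta Q0 f < +oo.

Definition VMO (beta : R) Q0 f : Prop :=
  BMO beta Q0 f /\ osc_modulus beta Q0 f r @[r --> 0^'+] --> 0.

End oscillation.

Section maximal_function.
Context {R : realType} {n : nat}.
Local Open Scope ereal_scope.

Definition frac_maximal (alpha : R) (f : 'rV[R]_n.+1 -> R)
    (x : 'rV[R]_n.+1) : \bar R :=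
  ereal_sup [set s | exists (a : 'rV[R]_n.+1) (l : R),
    [/\ (0 < l)%R, cube a l x &
        s = (l `^ (- (n.+1%:R - alpha)))%:E *
            \int[lebesgueRn]_(y in (cube a l : set (caratheodory_type _)))
              `|f y|%:E]].

End maximal_function.

(* Main.v *)
(* The dyadic cubes below are those of the grid adapted to [Q0 = cube a0 l0]; the
   content [gcontent] they define is comparable to [hcontent].  Enclose every
   dyadic cube [q] in [Q0] in an open subcube of [Q0] of three times its side, and
   let [c q] be a near-optimal constant for [f] there.  If [c r] is far from [c p]
   for subcubes [r] of [p], then [f - c p] is large on most of each such [r], so
   the content of the union of these [r] is controlled by that of a level set of
   [f - c p], hence by the oscillation of [f] on [p]; no Lebesgue measure is
   needed.  Iterating this stopping time gives a John-Nirenberg inequality: the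
   set where [|c r - c p| > j * const] for some [r] containing the point has
   content at most [2^-j * side(p)^beta].

   On a small cube [Q] compare the maximal function with [G], the supremum of the
   fractional means over the cubes that contain [Q].  Means over cubes larger than
   [Q] differ from means over enlarged cubes containing [Q] by the oscillation of
   [f] (small sides) or by a factor close to 1 (large sides), and means over cubes
   smaller than [Q] are controlled by the John-Nirenberg inequality.  This gives
   the integrability, the BMO bound and the VMO property.

   For quasicontinuity let [O] be a small open set off which [f] is continuous.
   The dyadic cubes half filled by [O] have a union of small content; off a
   neighbourhood of it every small cube contains a point outside [O] at which [f]
   is close to its mean over the cube, so the maximal function is continuous
   there. *)
Require Import Defs.
From mathcomp Require Import all_boot all_order all_algebra.
From mathcomp Require Import all_classical all_reals all_analysis.
From mathcomp Require Import measurable_realfun.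
From mathcomp Require Import ring lra zify.
Import Order.TTheory GRing.Theory Num.Theory.
Import numFieldNormedType.Exports.
Set Implicit Arguments.
Unset Strict Implicit.
Unset Printing Implicit Defensive.
Local Open Scope classical_set_scope.
Local Open Scope ring_scope.

(** * Contents defined by countable covers: subadditivity and comparison *)

Section countable_covers_theory.
Local Open Scope ereal_scope.
Context {R : realType} {T I : Type}.
Variables (S : I -> set T) (v : I -> R).
Hypothesis v_ge0 : forall i, (0 <= v i)%R.

Lemma cover_content_le (E : set T) (i : nat -> I) :
  E `<=` \bigcup_k S (i k) -> cover_content S v E <= \sum_(k <oo) (v (i k))%:E.
Proof. by move=> Ei; apply: ereal_inf_lbound; exists i. Qed.

Lemma cover_content_lt (E : set T) (x : \bar R) : cover_content S v E < x ->
  exists2 i : nat -> I, E `<=` \bigcup_k S (i k) &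
    \sum_(k <oo) (v (i k))%:E < x.
Proof. by move=> /ereal_inf_lt[_ [i Ei <-] ix]; exists i. Qed.

Lemma cover_content_glb (E : set T) (x : \bar R) :
  (forall i : nat -> I, E `<=` \bigcup_k S (i k) ->
    x <= \sum_(k <oo) (v (i k))%:E) -> x <= cover_content S v E.
Proof. by move=> h; apply: le_ereal_inf_tmp => _ [i Ei <-]; exact: h. Qed.

Hypothesis v_small : forall e : R, (0 < e)%R -> exists i, (v i <= e)%R.

(** Covers are full sequences indexed by [nat], so a finite cover has to be padded. Members of
    weight at most [e / 2 ^ k.+1] make the padding arbitrarily cheap. *)
Lemma small_cover (e : R) : (0 < e)%R ->
  exists i : nat -> I, \sum_(k <oo) (v (i k))%:E <= e%:E.
Proof.
move=> e0; have /choice[i iP] k : exists i, (v i <= e / (2 ^ k.+1)%:R)%R.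
  by apply: v_small; rewrite divr_gt0// ltr0n expn_gt0.
exists i; apply: le_trans (epsilon_trick0 xpredT (ltW e0)).
by apply: lee_nneseries => k _ //; rewrite lee_fin.
Qed.

Lemma small_cover_content0 : cover_content S v set0 = 0.
Proof.
apply/eqP; rewrite eq_le cover_content_ge0// andbT.
apply/lee_addgt0Pr => e e0; rewrite add0e.
have [i ie] := small_cover e0.
by apply: le_trans ie; exact: cover_content_le.
Qed.

Lemma cover_contentU (A B : set T) :
  cover_content S v (A `|` B) <= cover_content S v A + cover_content S v B.
Proof.
rewrite -bigcup2E.
apply: le_trans (cover_content_sigma_subadditive S v_ge0 _) _.
rewrite (nneseries_split 0 2); last by move=> *; exact: cover_content_ge0.
rewrite add0n [X in _ + X]eseries0; last first.
  by move=> [|[|k]] // _ _; rewrite /bigcup2/= small_cover_content0.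
by rewrite adde0 !big_nat_recr//= big_nil add0e.
Qed.

Lemma cover_content_bigcup (J : finType) (A : J -> set T) :
  cover_content S v (\bigcup_j A j) <= \sum_j cover_content S v (A j).
Proof.
have -> : \bigcup_j A j = \big[setU/set0]_(j <- index_enum J) A j.
  rewrite -bigcup_seq; apply/seteqP; split=> x [j _ Ajx]; exists j => //=.
  exact: mem_index_enum.
elim: (index_enum J) => [|j s ih]; first by rewrite !big_nil small_cover_content0.
by rewrite !big_cons; apply: le_trans (cover_contentU _ _) _; exact: leeD2l.
Qed.

(** The series runs over the codes of [J]. A code without preimage or outside [D] stands for the
    empty set and costs nothing. *)
Lemma cover_content_countable (J : countType) (D : pred J) (A : J -> set T)
    (c : J -> \bar R) : (forall j, 0 <= c j) ->
  (forall j, D j -> cover_content S v (A j) <= c j) ->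
  cover_content S v (\bigcup_(j in [set j | D j]) A j) <=
    \sum_(p <oo) (if @pickle_inv J p is Some j then if D j then c j else 0 else 0).
Proof.
move=> c0 Ac.
pose B p := if @pickle_inv J p is Some j then if D j then A j else set0 else set0.
apply: (@le_trans _ _ (cover_content S v (\bigcup_p B p))).
  apply: le_cover_content => x [j Dj Ajx]; exists (pickle j) => //.
  by rewrite /B pickleK_inv Dj.
apply: le_trans (cover_content_sigma_subadditive S v_ge0 _) _.
apply: lee_nneseries => [p _ _|p _]; first exact: cover_content_ge0.
rewrite /B; case: pickle_inv => [j|]; last by rewrite small_cover_content0.
by case: ifP => [/Ac//|_]; rewrite small_cover_content0.
Qed.

End countable_covers_theory.

(** In a cover by the sets [S'] each member may be replaced by its own covers by the sets [S];
    countable subadditivity sums the costs. *)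
Lemma cover_content_comparable (R : realType) (T I I' : Type)
    (S : I -> set T) (v : I -> R) (S' : I' -> set T) (v' : I' -> R) (C : R) :
  (forall i, 0 <= v i) -> (forall i, 0 <= v' i) -> 0 < C ->
  (forall i, (cover_content S v (S' i) <= (C * v' i)%:E)%E) ->
  forall E, (cover_content S v E <= C%:E * cover_content S' v' E)%E.
Proof.
move=> v0 v'0 C0 h E; rewrite muleC -lee_pdivrMr//.
apply: cover_content_glb => i Ei; rewrite lee_pdivrMr// muleC.
rewrite -nneseriesZl; last by move=> k _; rewrite lee_fin.
apply: (@le_trans _ _ (cover_content S v (\bigcup_k S' (i k)))).
  exact: le_cover_content.
apply: le_trans (cover_content_sigma_subadditive S v0 _) _.
apply: lee_nneseries => [k _ _|k _]; first exact: cover_content_ge0.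
exact: h.
Qed.

Section half_open_cubes.
Context {R : realType} {n : nat}.
Implicit Types (b x : 'rV[R]_n.+1).

Definition hcube b (s : R) : set 'rV[R]_n.+1 :=
  [set x | forall i, b 0 i <= x 0 i < b 0 i + s].

Lemma cube_sub_hcube b s : cube b s `<=` hcube b s.
Proof. by move=> x bx i; case/andP: (bx i) => /ltW -> ->. Qed.

Lemma hcube_sub_cube b s : 0 < s ->
  hcube b s `<=` cube (b - const_mx s) (3 * s).
Proof. by move=> s0 x bx i; rewrite !mxE; case/andP: (bx i) => h1 h2; lra. Qed.

End half_open_cubes.

(** * Dyadic grids *)
Section dyadic_grid.
Context {R : realType} {n : nat}.
Variables (a : 'rV[R]_n.+1) (l : R).
Implicit Types (x : 'rV[R]_n.+1) (q p : int * 'rV[int]_n.+1).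

Definition gside q : R := l * 2 ^ q.1.

Definition gcorner q : 'rV[R]_n.+1 := \row_i (a 0 i + gside q * (q.2 0 i)%:~R).

Definition gcube q : set 'rV[R]_n.+1 := hcube (gcorner q) (gside q).

Lemma gcubeP q x : gcube q x <-> forall i,
  a 0 i + gside q * (q.2 0 i)%:~R <= x 0 i < a 0 i + gside q * ((q.2 0 i)%:~R + 1).
Proof. by split=> h i; have := h i; rewrite mxE mulrDr mulr1 addrA. Qed.

(** Inclusion of dyadic cubes read off from the indices, independently of the corner and scale of
    the grid. It yields inclusion of the half-open cubes and of the open ones. *)
Definition nest q p : Prop := q.1 <= p.1 /\ forall i,
  (2 : R) ^ p.1 * (p.2 0 i)%:~R <= 2 ^ q.1 * (q.2 0 i)%:~R /\
  (2 : R) ^ q.1 * ((q.2 0 i)%:~R + 1) <= 2 ^ p.1 * ((p.2 0 i)%:~R + 1).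

Lemma nest_refl q : nest q q. Proof. by []. Qed.

Lemma nest_trans p q r : nest q p -> nest p r -> nest q r.
Proof.
move=> [qp h1] [pr h2]; split; first exact: le_trans pr.
by move=> i; have [u1 u2] := h1 i; have [v1 v2] := h2 i; split;
  [exact: le_trans u1|exact: le_trans v2].
Qed.

Lemma nest_eq q p : nest q p -> p.1 <= q.1 -> q = p.
Proof.
case: q p => [k m] [k' m'] [/= kk' h] k'k.
have kE : k = k' by apply/eqP; rewrite eq_le kk'.
subst k'; congr pair; apply/rowP => i; have [/=] := h i.
rewrite !ler_pM2l ?exprz_gt0// lerD2r !ler_int => h1 h2.
by apply/eqP; rewrite eq_le h1 h2.
Qed.

Hypothesis l0 : 0 < l.

Lemma gside_gt0 q : 0 < gside q.
Proof. by rewrite mulr_gt0// exprz_gt0. Qed.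

Lemma gside_le q p : (gside q <= gside p) = (q.1 <= p.1).
Proof. by rewrite ler_pM2l// ler_eXz2l// ltr1n. Qed.

Lemma gside_lt q p : (gside q < gside p) = (q.1 < p.1).
Proof. by rewrite !ltNge gside_le. Qed.

Lemma gside_lt_double q p : gside q < 2 * gside p -> q.1 <= p.1.
Proof.
have -> : 2 * gside p = gside (p.1 + 1, p.2).
  by rewrite /gside/= expfzDr ?pnatr_eq0// expr1z; ring.
by rewrite gside_lt ltzD1.
Qed.

Lemma nest_side q p : nest q p -> gside q <= gside p.
Proof. by case=> h _; rewrite gside_le. Qed.

Lemma nest_sub q p : nest q p -> gcube q `<=` gcube p.
Proof.
move=> [qp h] x /gcubeP xq; apply/gcubeP => i; have /andP[x1 x2] := xq i.
have [h1 h2] := h i; apply/andP; split.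
  apply: le_trans x1; rewrite lerD2l /gside -!mulrA ler_pM2l//.
by apply: (lt_le_trans x2); rewrite lerD2l /gside -!mulrA ler_pM2l.
Qed.

Lemma nest_cube_sub q p : nest q p ->
  cube (gcorner q) (gside q) `<=` cube (gcorner p) (gside p).
Proof.
move=> [qp h] x xq i; have := xq i; rewrite !mxE => /andP[x1 x2].
have [h1 h2] := h i; rewrite -(ler_pM2l l0) !mulrA -!/(gside _) in h1.
rewrite -(ler_pM2l l0) !mulrA -!/(gside _) !mulrDr !mulr1 in h2.
by apply/andP; split; lra.
Qed.

(** All endpoints are integer multiples of the smaller side. A common point gives strict
    inequalities between integers, which sharpen to the required weak ones. *)
Lemma nest_meet q p x : q.1 <= p.1 -> gcube q x -> gcube p x -> nest q p.
Proof.
move=> qp /gcubeP xq /gcubeP xp; split=> // i.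
have /andP[] := xq i; have /andP[] := xp i.
have [d pE] : exists d : nat, p.1 = q.1 + d%:Z.
  by exists `|p.1 - q.1|%N; rewrite gez0_abs ?subr_ge0// subrKC.
have {pE} : 2 ^ p.1 = 2 ^ q.1 * (2 ^+ d)%:~R :> R.
  by rewrite pE expfzDr ?pnatr_eq0// -exprnP rmorphXn.
move: (2 ^+ d : int) => D pE; rewrite /gside pE.
set m := q.2 0 i; set M := p.2 0 i; set z : R := 2 ^ q.1 => h1 h2 h3 h4.
have z0 : 0 < z by rewrite exprz_gt0.
have lz0 : 0 < l * z by rewrite mulr_gt0.
have e1 : z * D%:~R * M%:~R = z * (D * M)%:~R by rewrite rmorphM/= mulrA.
have e2 : z * D%:~R * (M%:~R + 1) = z * (D * (M + 1))%:~R.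
  by rewrite rmorphM/= rmorphD/= mulrA.
have e3 : z * (m%:~R + 1) = z * (m + 1)%:~R by rewrite rmorphD.
rewrite e1 e2 e3 !ler_pM2l// !ler_int.
rewrite -!(mulrA l) e1 in h1; rewrite -!(mulrA l) e2 in h2.
rewrite -!(mulrA l) in h3; rewrite -!(mulrA l) e3 in h4.
split.
  rewrite -ltzD1 -(@ltr_int R) -(ltr_pM2l lz0) -!mulrA; lra.
by rewrite lezD1 -(@ltr_int R) -(ltr_pM2l lz0) -!mulrA; lra.
Qed.

Lemma exists_level (s : R) : 0 < s -> exists k : int, s <= l * 2 ^ k < 2 * s.
Proof.
move=> s0; pose y := s / l; have y0 : 0 < y by rewrite divr_gt0.
have ln20 : 0 < ln (2 : R) by rewrite ln_gt0// ltr1n.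
(* The least integer above the base 2 logarithm of [s / l]; being off by less than 1 gives the
   factor 2. *)
pose k := Num.ceil (ln y / ln 2).
have yE : y = 2 `^ (ln y / ln 2).
  by rewrite /powR pnatr_eq0/= divfK ?gt_eqF// lnK.
exists k; rewrite -powR_intmul// (_ : s = l * y); last by rewrite mulrC divfK ?gt_eqF.
rewrite [2 * _]mulrCA (ler_pM2l l0) (ltr_pM2l l0).
have -> : 2 * y = 2 `^ (1 + ln y / ln 2).
  by rewrite powRD ?pnatr_eq0 ?implybT// powRr1// -yE.
apply/andP; split; first by rewrite {1}yE ler_powR ?ler1n ?ceil_ge.
rewrite /powR pnatr_eq0/= ltr_expR ltr_pM2r//.
have /andP[+ _] := ceil_itv (ln y / ln 2).
by rewrite -/k rmorphB/= ltrBlDr addrC.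
Qed.

Lemma gcube_exists (k : int) x : exists m, gcube (k, m) x.
Proof.
exists (\row_i Num.floor ((x 0 i - a 0 i) / (l * 2 ^ k))); apply/gcubeP => i.
rewrite !mxE /gside/=; set s := l * 2 ^ k.
have s0 : 0 < s by rewrite mulr_gt0// exprz_gt0.
have /andP[] := mem_rg1_floor ((x 0 i - a 0 i) / s).
rewrite ler_pdivlMr// ltr_pdivrMr// => h1 h2.
by apply/andP; split; lra.
Qed.

Lemma exists_gcube (s : R) x : 0 < s ->
  exists q, gcube q x /\ s <= gside q < 2 * s.
Proof.
move=> /exists_level[k ks]; have [m xm] := gcube_exists k x.
by exists (k, m).
Qed.

Lemma gcorner_in q : gcube q (gcorner q).
Proof. by move=> i; rewrite lexx ltrDl gside_gt0. Qed.

Lemma nest_parent q p : nest q p -> q <> p ->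
  exists2 r, nest q r & nest r p /\ gside r = 2 * gside q.
Proof.
move=> qp neq; have qp1 : q.1 < p.1.
  rewrite lt_neqAle (proj1 qp) andbT; apply/negP => /eqP e.
  by apply: neq; apply: nest_eq => //; rewrite e.
have [m xm] := gcube_exists (q.1 + 1) (gcorner q).
exists (q.1 + 1, m).
  by apply: nest_meet (gcorner_in q) xm; rewrite /= lerDl.
split; last by rewrite /gside/= expfzDr ?pnatr_eq0// expr1z; ring.
apply: nest_meet xm _; first by rewrite /= lezD1.
exact: nest_sub (gcorner_in q).
Qed.

Lemma hcube_cover b (s : R) : 0 < s ->
  exists2 q : {ffun 'I_n.+1 -> bool} -> int * 'rV[int]_n.+1,
    hcube b s `<=` \bigcup_d gcube (q d) & forall d, s <= gside (q d) < 2 * s.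
Proof.
move=> s0; have [[k m] [bm ks]] := exists_gcube b s0.
exists (fun d : {ffun 'I_n.+1 -> bool} => (k, \row_i (m 0 i + (d i)%:Z))) => //.
(* [d] records the coordinates in which [x] lies beyond the far face of the grid cube containing
   [b]. As [s] is at most its side, one shift per coordinate suffices. *)
move=> x bx; pose d := [ffun i => a 0 i + gside (k, m) * ((m 0 i)%:~R + 1) <= x 0 i].
exists d => //; apply/gcubeP => i; rewrite !mxE /d ffunE /=.
have /gcubeP/(_ i)/andP[] := bm; have /andP[] := bx i; rewrite /gside/= in ks *.
move: ks; set S := l * 2 ^ k; rewrite rmorphD/= => /andP[sS _] h1 h2 h3 h4.
by have [h|h] := leP (a 0 i + S * ((m 0 i)%:~R + 1)) (x 0 i);
  rewrite ?mulr1z ?mulr0z; apply/andP; split; lra.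
Qed.

End dyadic_grid.

(** * Lower bound for the volume of box covers of a cube *)

Section volume.
Context {R : realType} {n : nat}.
Local Open Scope ereal_scope.
Local Notation V := 'rV[R]_n.+1.

Lemma lebesgue_measure_co (x y : R) :
  lebesgue_measure `[x, y[%classic = (Num.max 0 (y - x))%:E.
Proof.
rewrite lebesgue_measure_itv/= lte_fin; case: ltP => xy.
  by rewrite -EFinD max_r// subr_ge0 ltW.
by rewrite max_l// subr_le0.
Qed.

Lemma lebesgue_measure_oo (x y : R) :
  lebesgue_measure `]x, y[%classic = (Num.max 0 (y - x))%:E.
Proof. by rewrite -lebesgue_measure_co !lebesgue_measure_itv. Qed.

(* Fubini for indicators of boxes: the hypothesis is integrated over one
   coordinate after the other. *)
Lemma integrate_coordinates (J : 'I_n.+1 -> R * R) (I : nat -> 'I_n.+1 -> R * R)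
    (s : seq 'I_n.+1) (M : R) (w : nat -> R) :
  (0 <= M)%R -> (forall k, (0 <= w k)%R) -> uniq s ->
  (forall x : 'I_n.+1 -> R,
    (M * \prod_(i <- s) \1_`](J i).1, (J i).2[ (x i))%:E <=
    \sum_(k <oo) (w k * \prod_(i <- s) \1_`[(I k i).1, (I k i).2[ (x i))%:E) ->
  (M * \prod_(i <- s) Num.max 0 ((J i).2 - (J i).1))%:E <=
  \sum_(k <oo) (w k * \prod_(i <- s) Num.max 0 ((I k i).2 - (I k i).1))%:E.
Proof.
elim: s M w => [|j s ih] M w M0 w0.
  move=> _ /(_ (fun=> 0%R)); rewrite !big_nil => /le_trans; apply.
  by apply: lee_nneseries => k _; rewrite !big_nil// lee_fin mulr_ge0.
move=> /= /andP[js us] h; rewrite big_cons mulrA.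
under eq_eseriesr do rewrite big_cons mulrA.
apply: ih => //; [|by move=> k; rewrite mulr_ge0// le_max lexx|].
  by rewrite mulr_ge0// le_max lexx.
move=> x.
set c : R := (\prod_(i <- s) \1_`](J i).1, (J i).2[ (x i))%R.
pose d (k : nat) : R := (\prod_(i <- s) \1_`[(I k i).1, (I k i).2[ (x i))%R.
have c0 : (0 <= c)%R by apply: prodr_ge0.
have d0 k : (0 <= d k)%R by apply: prodr_ge0.
have : \int[lebesgue_measure]_t ((M * c)%:E * (\1_`](J j).1, (J j).2[ t)%:E) <=
    \int[lebesgue_measure]_t
      (\sum_(k <oo) ((w k * d k)%:E * (\1_`[(I k j).1, (I k j).2[ t)%:E)).
  apply: ge0_le_integral => //=.
  - by move=> t _; rewrite -EFinM lee_fin !mulr_ge0.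
  - apply: measurable_funeM; exact/measurable_EFinP/measurable_indic.
  - apply: ge0_emeasurable_sum => [k t _ _|k _].
      by rewrite -EFinM lee_fin !mulr_ge0.
    by apply: measurable_funeM; exact/measurable_EFinP/measurable_indic.
  - move=> t _; have := h (fun i => if i == j then t else x i).
    rewrite big_cons eqxx.
    (* Moving the coordinate [j] leaves the other factors unchanged because [j] does not occur in
       [s]. *)
    have E F : (\prod_(i <- s) F i (if i == j then t else x i) =
        \prod_(i <- s) F i (x i) :> R)%R.
      by apply: eq_big_seq => i si; case: eqP si => // ->; rewrite (negPf js).
    rewrite (E (fun i t => \1_`](J i).1, (J i).2[ t)) -/c mulrCA mulrC EFinM.
    move/le_trans; apply; apply: lee_nneseries => k _ //.
      rewrite lee_fin mulr_ge0// prodr_ge0//.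
    rewrite big_cons eqxx (E (fun i t => \1_`[(I k i).1, (I k i).2[ t)) -/(d k).
    by rewrite mulrCA mulrC EFinM.
rewrite integral_nneseries//; last 2 first.
- by move=> k; apply: measurable_funeM; exact/measurable_EFinP/measurable_indic.
- by move=> k t _; rewrite -EFinM lee_fin !mulr_ge0.
rewrite ge0_integralZl//=; last 2 first.
- by exact/measurable_EFinP/measurable_indic.
- by rewrite lee_fin mulr_ge0.
rewrite integral_indic// setIT.
rewrite /= lebesgue_measure_oo -EFinM mulrAC => /le_trans; apply;
  apply: lee_nneseries => k _.
  by move=> _; apply: integral_ge0 => t _; rewrite -EFinM lee_fin !mulr_ge0.
rewrite ge0_integralZl//=; last 2 first.
- by exact/measurable_EFinP/measurable_indic.
- by rewrite lee_fin mulr_ge0.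
by rewrite integral_indic// setIT /= lebesgue_measure_co -EFinM mulrAC.
Qed.

(** The indicator of the cube, a product over coordinates, is pointwise at most the sum of the
    indicators of the boxes; [integrate_coordinates] turns this into volumes. *)
Lemma cube_volume_le (a : V) (l : R) (ab : nat -> V * V) : (0 < l)%R ->
  cube a l `<=` \bigcup_k box (ab k) ->
  (l ^+ n.+1)%:E <= \sum_(k <oo) (box_volume (ab k))%:E.
Proof.
move=> l0 cov.
have := @integrate_coordinates (fun i => (a 0 i, a 0 i + l)%R)
  (fun k i => ((ab k).1 0%R i, (ab k).2 0%R i)) (index_enum 'I_n.+1) 1 (fun=> 1%R)
  ler01 (fun=> ler01) (index_enum_uniq _).
under eq_eseriesr do rewrite mul1r.
rewrite mul1r /= (eq_bigr (fun=> l)); last first.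
  by move=> i _; rewrite addrAC subrr add0r max_r// ltW.
rewrite prodr_const card_ord; apply => x.
have [xa|xa] := pselect (cube a l (\row_i x i)); last first.
  rewrite [X in X%:E <= _](_ : _ = 0%R); first by apply: nneseries_ge0 => k _ _;
    rewrite lee_fin mulr_ge0// prodr_ge0.
  apply/eqP; rewrite mul1r; apply: contra_notT xa => p0 i.
  rewrite mxE; move: p0; rewrite (bigD1 i)//= indicE; case: (boolP (_ \in _));
    last by rewrite mul0r eqxx.
  by rewrite inE/= in_itv.
have [k _ xk] := cov _ xa.
apply: (@le_trans _ _ 1); first by rewrite lee_fin mul1r; apply: prodr_ile1 => i _;
  rewrite indicE; case: (_ \in _); rewrite ?lexx ?ler01.
have e1 : (1 * \prod_i \1_`[(ab k).1 0 i, (ab k).2 0 i[ (x i) = 1 :> R)%R.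
  rewrite mul1r big1// => i _; rewrite indicE mem_set//= in_itv/=.
  by have := xk i; rewrite mxE.
rewrite (@nneseriesD1 _ _ k xpredT)//= ?e1; last by move=> *;
  rewrite lee_fin mulr_ge0// prodr_ge0.
by rewrite leeDl//; apply: nneseries_ge0 => *; rewrite lee_fin mulr_ge0// prodr_ge0.
Qed.

End volume.

Lemma powR_le {R : realType} (x y r : R) : 0 <= r -> 0 <= x -> x <= y ->
  x `^ r <= y `^ r.
Proof. by move=> r0 x0 xy; apply: ge0_ler_powR; rewrite ?nnegrE//; lra. Qed.

(** * Hausdorff contents of dyadic grids *)
Section dyadic_content.
Context {R : realType} {n : nat}.
Variable beta : R.
Hypothesis beta_gt0 : 0 < beta.
Implicit Types (a b : 'rV[R]_n.+1) (l s : R) (E : set 'rV[R]_n.+1).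
Local Open Scope ereal_scope.

Definition gcontent a l : set 'rV[R]_n.+1 -> \bar R :=
  cover_content (gcube a l) (fun q => (gside l q `^ beta)%R).

(** A cube of side [s] is covered by [2 ^+ n.+1] grid cubes of side below [2 * s], each of weight at
    most [2]^ beta * s [^ beta]. *)
Definition grid_const : R := (2 ^+ n.+1 * 2 `^ beta)%R.

Lemma grid_const_gt0 : (0 < grid_const)%R.
Proof. by rewrite mulr_gt0 ?exprn_gt0 ?powR_gt0. Qed.

Lemma gweight_ge0 l (q : int * 'rV[int]_n.+1) : (0 <= gside l q `^ beta)%R.
Proof. exact: powR_ge0. Qed.

Lemma gcontent_ge0 a l E : 0 <= gcontent a l E.
Proof. exact: cover_content_ge0 (gweight_ge0 l) _. Qed.

Lemma le_gcontent a l E E' : E `<=` E' -> gcontent a l E <= gcontent a l E'.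
Proof. exact: le_cover_content. Qed.

Lemma hcontentE E : hcontent beta E = gcontent 0%R 1%R E.
Proof.
rewrite /hcontent /gcontent; congr cover_content; last first.
  by apply/funext => q; rewrite /gside mul1r.
apply/funext => q; apply/seteqP; split=> x xq.
  by apply/gcubeP => i; have := xq i; rewrite /gside mul1r mxE !add0r.
by move=> i; move/gcubeP/(_ i) : xq; rewrite /gside mul1r mxE !add0r.
Qed.

Section fixed_grid.
Variables (a : 'rV[R]_n.+1) (l : R).
Hypothesis l0 : (0 < l)%R.

Lemma gweight_small (e : R) : (0 < e)%R ->
  exists q : int * 'rV[int]_n.+1, (gside l q `^ beta <= e)%R.
Proof.
move=> e0; have s0 : (0 < e `^ beta^-1 / 2)%R by rewrite divr_gt0 ?powR_gt0.
have [q [_ /andP[_ qs]]] := exists_gcube (0 : 'rV[R]_n.+1)%R l0 0%R s0.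
exists q; rewrite mulrC divfK ?pnatr_eq0// in qs.
rewrite [leRHS](_ : _ = (e `^ beta^-1) `^ beta)%R.
  by apply: powR_le (ltW qs); rewrite ltW// gside_gt0.
by rewrite -powRrM mulVf ?gt_eqF// powRr1// ltW.
Qed.

Lemma gcontent0 : gcontent a l set0 = 0.
Proof. exact: small_cover_content0 (gweight_ge0 l) gweight_small. Qed.

Lemma gcontentU E E' :
  gcontent a l (E `|` E') <= gcontent a l E + gcontent a l E'.
Proof. exact: cover_contentU (gweight_ge0 l) gweight_small _ _. Qed.

Lemma gcontent_bigcup (J : finType) (A : J -> set 'rV[R]_n.+1) :
  gcontent a l (\bigcup_j A j) <= \sum_j gcontent a l (A j).
Proof. exact: (cover_content_bigcup _ (gweight_ge0 l) gweight_small). Qed.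

Lemma gcontent_bigcup_nat (A : nat -> set 'rV[R]_n.+1) :
  gcontent a l (\bigcup_k A k) <= \sum_(k <oo) gcontent a l (A k).
Proof. exact: cover_content_sigma_subadditive (gweight_ge0 l) _. Qed.

Lemma gcontent_gcube q : gcontent a l (gcube a l q) <= (gside l q `^ beta)%:E.
Proof.
apply/lee_addgt0Pr => e e0.
have [i ie] := small_cover (gweight_ge0 l) gweight_small e0.
apply: (@le_trans _ _ (\sum_(k <oo) (gside l (if k is k'.+1 then i k' else q) `^
  beta)%:E)).
  by apply: cover_content_le => x xq; exists 0%N.
rewrite nneseries_recl//=; last by move=> k _; rewrite lee_fin powR_ge0.
apply: leeD2l; apply: le_trans ie.
rewrite -(@nneseries_addn _ _ 1); last by move=> k; rewrite lee_fin powR_ge0.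
by apply: lee_nneseries => k _; rewrite ?lee_fin ?powR_ge0// addn1.
Qed.

Lemma gcontent_hcube b s : (0 < s)%R ->
  gcontent a l (hcube b s) <= (grid_const * s `^ beta)%:E.
Proof.
move=> s0; have [q bq qs] := hcube_cover a l0 b s0.
apply: le_trans (le_gcontent _ _ bq) _; apply: le_trans (gcontent_bigcup _) _.
apply: (@le_trans _ _ (\sum_(d : {ffun 'I_n.+1 -> bool}) ((2 * s) `^ beta)%:E)).
  apply: lee_sum => d _; apply: le_trans (gcontent_gcube _) _.
  have /andP[_ h] := qs d.
  by rewrite lee_fin powR_le// ltW// gside_gt0.
rewrite sumEFin sumr_const card_ffun card_bool card_ord lee_fin.
by rewrite powRM ?ler0n ?(ltW s0)// -(mulr_natl _ (2 ^ n.+1)) natrX mulrA.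
Qed.

Lemma gcontent_cube b s : (0 < s)%R ->
  gcontent a l (cube b s) <= (grid_const * s `^ beta)%:E.
Proof.
by move=> s0; apply: le_trans (gcontent_hcube b s0); exact/le_gcontent/cube_sub_hcube.
Qed.

End fixed_grid.

Lemma gcontent_comparable a l a' l' E : (0 < l)%R -> (0 < l')%R ->
  gcontent a l E <= grid_const%:E * gcontent a' l' E.
Proof.
move=> l0 l'0; apply: cover_content_comparable => //.
- exact: gweight_ge0.
- exact: gweight_ge0.
- exact: grid_const_gt0.
- by move=> q; apply: gcontent_hcube => //; exact: gside_gt0.
Qed.

Hypothesis beta_le : (beta <= n.+1%:R)%R.

Lemma gcube_box a l q :
  gcube a l q = box (gcorner a l q, gcorner a l q + const_mx (gside l q))%R.
Proof.
by apply/seteqP; split=> x h i; have := h i; rewrite !mxE.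
Qed.

Lemma gcube_volume a l q : (0 < l)%R ->
  box_volume (gcorner a l q, gcorner a l q + const_mx (gside l q))%R =
  (gside l q ^+ n.+1)%R.
Proof.
move=> l0; rewrite /box_volume /= (eq_bigr (fun=> gside l q)).
  by rewrite prodr_const card_ord.
by move=> i _; rewrite !mxE addrAC subrr add0r max_r// ltW// gside_gt0.
Qed.

(** For a side [t <= s] the volume [t ^+ n.+1] is at most [s]^ (n.+1%:R - beta) * t [^ beta]. A
    cover using a side larger than [s] already costs enough by the assumed bound on [E]. *)
Lemma lebesgue_outer_le_gcontent a l s E : (0 < l)%R -> (0 < s)%R ->
  lebesgue_outer E <= (s ^+ n.+1)%:E ->
  lebesgue_outer E <= (s `^ (n.+1%:R - beta))%:E * gcontent a l E.
Proof.
move=> l0 s0 Es; have c0 : (0 < s `^ (n.+1%:R - beta))%R by rewrite powR_gt0.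
rewrite muleC -lee_pdivrMr//; apply: cover_content_glb => i Ei.
rewrite lee_pdivrMr// muleC.
have powE (t : R) : (0 < t)%R -> (t ^+ n.+1 = t `^ (n.+1%:R - beta) * t `^ beta)%R.
  move=> t0; rewrite -powRD ?subrK ?powR_mulrn// ?ltW//.
  by rewrite gt_eqF ?implybT.
have [[k ks]|ks] := pselect (exists k, s < gside l (i k))%R.
  apply: le_trans Es _; rewrite powE// EFinM; apply: lee_wpmul2l.
    by rewrite lee_fin ltW.
  rewrite (@nneseriesD1 _ _ k xpredT)//=; last by move=> *; rewrite lee_fin powR_ge0.
  rewrite -[leLHS]adde0 leeD//; last by apply: nneseries_ge0 => *;
    rewrite lee_fin powR_ge0.
  by rewrite lee_fin powR_le// ltW.
rewrite -nneseriesZl; last by move=> *; rewrite lee_fin powR_ge0.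
apply: (@le_trans _ _ (\sum_(k <oo) (gside l (i k) ^+ n.+1)%:E)).
  under eq_eseriesr => k _ do rewrite -(gcube_volume a)//.
  apply: cover_content_le => x /Ei[k _]; rewrite gcube_box => xk.
  by exists k.
apply: lee_nneseries => [k _ _|k _].
  by rewrite lee_fin exprn_ge0// ltW// gside_gt0.
have k0 := gside_gt0 l0 (i k).
rewrite powE// -EFinM lee_fin ler_wpM2r ?powR_ge0//.
apply: powR_le; rewrite ?subr_ge0 ?(ltW k0)//.
by rewrite leNgt; apply/negP => h; apply: ks; exists k.
Qed.

Lemma lebesgue_outer_cube b s : (0 < s)%R ->
  lebesgue_outer (cube b s) = (s ^+ n.+1)%:E.
Proof.
move=> s0; apply/eqP; rewrite eq_le; apply/andP; split.
  (* One genuine box, followed by degenerate boxes of volume 0. *)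
  pose B k := (b, if k is 0%N then b + const_mx s else b)%R.
  apply: (@le_trans _ _ (\sum_(k <oo) (box_volume (B k))%:E)).
    apply: cover_content_le => x xb; exists 0%N => // i.
    by have := xb i; rewrite !mxE => /andP[/ltW -> ->].
  rewrite nneseries_recl//=; last by move=> *; rewrite lee_fin box_volume_ge0.
  rewrite eseries0 ?adde0.
    rewrite /box_volume /= (eq_bigr (fun=> s)) ?prodr_const ?card_ord//.
    by move=> i _; rewrite !mxE addrAC subrr add0r max_r// ltW.
  by case=> // k _ _; rewrite /box_volume big_ord_recl /= subrr maxxx mul0r.
by apply: cover_content_glb => ab; exact: cube_volume_le.
Qed.

Lemma gcontent_ge_cube a l b s E : (0 < l)%R -> (0 < s)%R -> cube b s `<=` E ->
  (s `^ beta)%:E <= gcontent a l E.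
Proof.
move=> l0 s0 bE; apply: le_trans (le_gcontent _ _ bE).
have := @lebesgue_outer_le_gcontent a l s (cube b s) l0 s0.
rewrite lebesgue_outer_cube// => /(_ (lexx _)).
rewrite (_ : s ^+ n.+1 = s `^ (n.+1%:R - beta) * s `^ beta)%R; last first.
  by rewrite -powRD ?subrK ?powR_mulrn ?gt_eqF ?implybT// ?ltW.
by rewrite EFinM lee_pmul2l// lte_fin powR_gt0.
Qed.

End dyadic_content.

(** * Stopping cubes and the John-Nirenberg inequality *)
Section stopping.
Context {R : realType} {n : nat}.
Local Open Scope ereal_scope.

Lemma nneseries_unique (Q : pred nat) (x : \bar R) : 0 <= x ->
  (forall p p', Q p -> Q p' -> p = p') ->
  \sum_(p <oo) (if Q p then x else 0) <= x.
Proof.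
move=> x0 Q1; have [[p Qp]|Q0] := pselect (exists p, Q p).
  rewrite (@nneseriesD1 _ _ p xpredT)//= ?Qp; last by move=> k _; case: ifP.
  rewrite eseries0 ?adde0// => k _ /= kp; case: ifP => // Qk.
  by rewrite (Q1 _ _ Qk Qp) eqxx in kp.
rewrite eseries0// => k _ _; case: ifP => // Qk.
by exfalso; apply: Q0; exists k.
Qed.

(** After interchanging the two sums, each [v i] is charged by at most one member of [U]. *)
Lemma nneseries_disjoint (J : countType) (U : pred J) (r : J -> nat -> bool)
    (v : nat -> \bar R) : (forall i, 0 <= v i) ->
  (forall i j j', U j -> U j' -> r j i -> r j' i -> j = j') ->
  \sum_(p <oo) (if @pickle_inv J p is Some j then
     if U j then \sum_(i <oo) (if r j i then v i else 0) else 0 else 0) <=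
  \sum_(i <oo) v i.
Proof.
move=> v0 rU.
pose b p i := if @pickle_inv J p is Some j then U j && r j i else false.
apply: (@le_trans _ _ (\sum_(p <oo) \sum_(i <oo) (if b p i then v i else 0))).
  apply: lee_nneseries => p _; rewrite /b; case: pickle_inv => [j|] //.
  - by move=> _; case: ifP => // _; apply: nneseries_ge0 => i _ _; case: ifP.
  - by case: (U j) => //=; apply: nneseries_ge0.
  - by apply: nneseries_ge0.
rewrite nneseries_interchange; last by move=> p i; case: ifP.
apply: lee_nneseries => i _ //.
  by move=> _; apply: nneseries_ge0 => p _ _; case: ifP.
apply: nneseries_unique => // p p'; rewrite /b.
have := @pickle_invK J p; case: pickle_inv => [j|]//= pj.
have := @pickle_invK J p'; case: pickle_inv => [j'|]//= p'j.
by move=> /andP[Uj rj] /andP[Uj' rj']; rewrite -pj -p'j (rU i j j').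
Qed.

Local Notation D := (int * 'rV[int]_n.+1)%type.
Local Notation V := 'rV[R]_n.+1.
Local Notation nest := (@nest R n).
Implicit Types (q p r t : D) (F : set D) (G E : set V).

Definition maximal_in F q := F q /\ forall p, F p -> nest q p -> p = q.

(** Passing to a strictly larger cube of [F] raises the level, which [k] bounds; the induction is on
    the distance to [k]. *)
Lemma exists_maximal F q (k : int) : (forall p, F p -> (p.1 <= k)%R) -> F q ->
  exists2 p, maximal_in F p & nest q p.
Proof.
move=> Fk; move: {2}`|k - q.1|%N (leqnn `|k - q.1|%N) => m.
elim: m q => [|m ih] q qm Fq.
  exists q => //; split=> // p Fp qp; apply/esym/(nest_eq qp).
  by have := Fk _ Fp; have := Fk _ Fq; lia.
have [maxq|/not_andP[//|/existsNP[p]]] := pselect (maximal_in F q); first by exists q.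
move=> /not_implyP[Fp /not_implyP[qp pq]].
have qp1 : (q.1 < p.1)%R.
  rewrite ltNge; apply/negP => pq1; apply: pq; exact/esym/(nest_eq qp).
have [|r maxr pr] := ih p _ Fp; last by exists r => //; exact: nest_trans pr.
by have := Fk _ Fp; lia.
Qed.

Variable beta : R.
Hypothesis beta_gt0 : (0 < beta)%R.
Variables (a : 'rV[R]_n.+1) (l : R).
Hypothesis l0 : (0 < l)%R.
Local Notation H := (gcontent beta a l).

(* A stopping cube contained in no [P i] is essentially filled by those [P i]
   which it contains, and maximal stopping cubes are disjoint. *)
Lemma stopping_cover F G (P : nat -> D) (X : D -> set V) (M : R) E (k : int) :
  (0 <= M)%R -> (forall q, F q -> (q.1 <= k)%R) ->
  (forall q, F q -> (2^-1 * gside l q `^ beta)%:E <= H (gcube a l q `&` G)) ->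
  G `<=` \bigcup_i gcube a l (P i) ->
  (forall t, (exists2 q, maximal_in F q & nest q t) ->
    (exists i, t = P i) \/ F t -> H (X t) <= (M * gside l t `^ beta)%:E) ->
  (forall x, E x -> exists2 q, maximal_in F q &
    forall t, nest q t -> (exists i, t = P i) \/ t = q -> X t x) ->
  H E <= (3 * M)%:E * \sum_(i <oo) (gside l (P i) `^ beta)%:E.
Proof.
move=> M0 Fk FG GP HX EX.
pose w q : \bar R := (gside l q `^ beta)%:E.
have w0 q : 0 <= w q by rewrite lee_fin powR_ge0.
(* [good] marks covering cubes that contain a maximal stopping cube, [U] the maximal stopping cubes
   inside no covering cube, and [r q i] the covering cubes inside [q]. *)
pose good i := `[< exists2 q, maximal_in F q & nest q (P i) >].
pose U q := `[< maximal_in F q /\ forall i, ~ nest q (P i) >].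
pose r q i := `[< nest (P i) q >].
(* The factor 2 is the inverse of the density with which [G] fills a stopping cube. A covering cube
   that meets [q] lies inside it, by the choice of [U]. *)
have fill q : U q -> w q <= 2%:E * \sum_(i <oo) (if r q i then w (P i) else 0).
  move=> /asboolP[maxq qP]; rewrite muleC -lee_pdivrMr// muleC.
  apply: le_trans (FG _ maxq.1) _.
  pose A i := if r q i then gcube a l (P i) else set0.
  apply: (@le_trans _ _ (H (\bigcup_i A i))).
    apply: le_gcontent => x [qx /GP[i _ Pix]]; exists i => //.
    rewrite /A /r; case: asboolP => // nPq.
    have [Pq|qPi] := leP (P i).1 q.1; first by apply: nPq; exact: nest_meet Pix qx.
    by apply: (qP i); apply: (nest_meet l0 _ qx Pix); exact: ltW.
  apply: le_trans (gcontent_bigcup_nat beta a l _) _.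
  apply: lee_nneseries => i _; first by move=> _; exact: gcontent_ge0.
  by rewrite /A; case: ifP => _; rewrite ?gcontent0//; exact: gcontent_gcube.
pose Y := \bigcup_(q in [set q | U q]) X q.
pose Z := \bigcup_i (if good i then X (P i) else set0).
apply: (@le_trans _ _ (H Z + H Y)).
  apply: le_trans (gcontentU beta_gt0 a l0 Z Y); apply: le_gcontent.
  move=> x /EX[q maxq qX]; have [[i qPi]|nqP] := pselect (exists i, nest q (P i)).
    left; exists i => //; rewrite ifT; last by apply/asboolP; exists q.
    by apply: qX => //; left; exists i.
  right; exists q; last by apply: qX => //; right.
  by apply/asboolP; split=> // i qPi; apply: nqP; exists i.
pose S := \sum_(i <oo) w (P i).
have S0 : 0 <= S by apply: nneseries_ge0.
(* One share pays for the good covering cubes, two for the stopping cubes in [U]. *)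
have -> : (3 * M)%:E * S = M%:E * S + (2 * M)%:E * S.
  by rewrite -ge0_muleDl ?lee_fin ?mulr_ge0// -EFinD; congr (_%:E * _); lra.
have Xw t : (exists2 q, maximal_in F q & nest q t) ->
    (exists i, t = P i) \/ F t -> H (X t) <= M%:E * w t.
  by move=> h1 h2; rewrite -EFinM; exact: HX.
apply: leeD.
  rewrite -nneseriesZl//; apply: le_trans (gcontent_bigcup_nat beta a l _) _.
  apply: lee_nneseries => i _; first by move=> _; exact: gcontent_ge0.
  case: ifPn => [/asboolP gi|_]; first by apply: Xw => //; left; exists i.
  by rewrite gcontent0// mule_ge0// lee_fin.
apply: (@le_trans _ _ (\sum_(p <oo) (if @pickle_inv D p is Some q then
    if U q then M%:E * w q else 0 else 0))).
  apply: (cover_content_countable (gweight_ge0 beta l) (gweight_small beta_gt0 l0)).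
    by move=> q; rewrite mule_ge0// lee_fin.
  move=> q /asboolP[maxq _]; apply: Xw; last by right; case: maxq.
  by exists q => //; exact: nest_refl.
apply: (@le_trans _ _ (\sum_(p <oo) ((2 * M)%:E *
    (if @pickle_inv D p is Some q then
      if U q then \sum_(i <oo) (if r q i then w (P i) else 0) else 0 else 0)))).
  apply: lee_nneseries => p _.
    by case: pickle_inv => // q; case: ifP => // _; rewrite mule_ge0// lee_fin.
  case: pickle_inv => [q|]; last by rewrite mule0.
  case: ifP => [Uq|_]; last by rewrite mule0.
  by rewrite mulrC EFinM -muleA lee_wpmul2l ?lee_fin// fill.
rewrite nneseriesZl; last first.
  move=> p _; case: pickle_inv => // q; case: ifP => // _.
  by apply: nneseries_ge0 => i _ _; case: ifP.
apply: lee_wpmul2l; first by rewrite lee_fin mulr_ge0.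
apply: nneseries_disjoint => // i q q'.
move=> /asboolP[maxq _] /asboolP[maxq' _] /asboolP Piq /asboolP Piq'.
have x := gcorner_in a l0 (P i).
have [qq'|q'q] := leP q.1 q'.1.
  apply/esym; apply: maxq.2; first by case: maxq'.
  exact: nest_meet qq' (nest_sub l0 Piq x) (nest_sub l0 Piq' x).
apply: maxq'.2; first by case: maxq.
exact: (nest_meet l0 (ltW q'q) (nest_sub l0 Piq' x) (nest_sub l0 Piq x)).
Qed.

End stopping.

Section john_nirenberg.
Context {R : realType} {n : nat}.
Variable beta : R.
Hypothesis beta_gt0 : 0 < beta.
Hypothesis beta_le : beta <= n.+1%:R.
Variables (a : 'rV[R]_n.+1) (l : R).
Hypothesis l0 : 0 < l.
Local Notation D := (int * 'rV[int]_n.+1)%type.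
Local Notation V := 'rV[R]_n.+1.
Local Notation nest := (@nest R n).
Local Notation H := (gcontent beta a l).
Implicit Types (q p r t : D).

(** The grid is adapted to [cube a l], which is the open version of the grid cube with this
    index. *)
Definition top_index : D := (0, 0).

Lemma top_side : gside l top_index = l.
Proof. by rewrite /gside expr0z mulr1. Qed.

Lemma top_cube : cube (gcorner a l top_index) (gside l top_index) = cube a l.
Proof.
by rewrite top_side; congr cube; apply/rowP => i; rewrite !mxE mulr0 addr0.
Qed.

Lemma nest_top_sub q : nest q top_index ->
  cube (gcorner a l q) (gside l q) `<=` gcube a l q `&` cube a l.
Proof.
move=> qt; rewrite subsetI; split; first exact: cube_sub_hcube.
by rewrite -top_cube; exact: nest_cube_sub.
Qed.

Lemma nest_top q x : gside l q < 2 * l -> cube a l x -> gcube a l q x ->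
  nest q top_index.
Proof.
move=> ql; rewrite -[cube a l]top_cube => /cube_sub_hcube ax qx.
by apply: (nest_meet l0 _ qx ax); apply: (gside_lt_double l0); rewrite top_side.
Qed.

Lemma gcontent_nest_top q : nest q top_index ->
  ((gside l q `^ beta)%:E <= H (gcube a l q `&` cube a l))%E.
Proof.
move=> qt; apply: gcontent_ge_cube (nest_top_sub qt) => //; exact: gside_gt0.
Qed.

Variables (f : V -> R) (c : D -> R) (K : R) (p0 : D).
Hypothesis K0 : 0 < K.
Hypothesis p0_top : nest p0 top_index.
Hypothesis osc : forall q (t : R), nest q p0 -> 0 < t ->
  (H [set x | (gcube a l q `&` cube a l) x /\ (t < `|f x - c q|)%R] <=
   (K * gside l q `^ beta / t)%:E)%E.

Lemma mean_parent q r : nest q r -> nest r p0 -> gside l r = 2 * gside l q ->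
  `|c q - c r| <= 2 * (2 `^ beta + 2) * K.
Proof.
move=> qr rp0 rq; set B := 2 `^ beta; have B0 : 0 < B by rewrite powR_gt0.
have qp0 := nest_trans qr rp0.
rewrite leNgt; apply/negP => big; pose t := (B + 2) * K.
have t0 : 0 < t by rewrite mulr_gt0// addr_gt0.
have s0 : 0 < gside l q `^ beta by rewrite powR_gt0// gside_gt0.
have := gcontent_nest_top (nest_trans qp0 p0_top).
apply/negP; rewrite -ltNge.
pose E p := [set x | (gcube a l p `&` cube a l) x /\ t < `|f x - c p|].
have sub : gcube a l q `&` cube a l `<=` E q `|` E r.
  move=> x [qx Qx]; have [h|h] := ltP t `|f x - c q|; first by left.
  right; split; first by split=> //; exact: (nest_sub l0 qr qx).
  have : `|c q - c r| <= `|f x - c q| + `|f x - c r|.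
    by rewrite [X in _ <= X + _]distrC; exact: ler_distD.
  by rewrite /t in h *; lra.
apply: (le_lt_trans (le_gcontent _ _ _ sub)).
apply: (le_lt_trans (gcontentU beta_gt0 a l0 _ _)).
apply: (le_lt_trans (leeD (osc qp0 t0) (osc rp0 t0))).
rewrite -EFinD lte_fin rq powRM ?ltW ?gside_gt0// -/B.
move: (gside l q `^ beta) s0 => s s0.
have -> : K * s / t + K * (B * s) / t = s * ((1 + B) / (B + 2)).
  by rewrite /t; field; rewrite !gt_eqF//; lra.
by rewrite gtr_pMr// ltr_pdivrMr; lra.
Qed.

(** The stopping threshold 18 plus the largest jump from a cube to its parent, in units of [K]. *)
Definition jn_const : R := 18 + 2 * (2 `^ beta + 2).

Lemma jn_const_gt0 : 0 < jn_const.
Proof. by have := powR_ge0 2 beta; rewrite /jn_const; lra. Qed.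

(** A level set of the dyadic maximal function of the increments [c r - c p]. *)
Definition excess (j : nat) p : set V :=
  [set x | exists2 r, nest r p & gcube a l r x /\
    j%:R * jn_const * K < `|c r - c p|].

(** Induction on [j]: stop at the first cubes whose constant is more than [18 * K] away from [c p],
    and apply the induction hypothesis in the cubes supplied by [stopping_cover]. Each round costs
    the factor [3 * 6^-1]. *)
Lemma john_nirenberg j p : nest p p0 ->
  (H (excess j p) <= ((2^-1) ^+ j * gside l p `^ beta)%:E)%E.
Proof.
elim: j p => [|j ih] p pp0.
  rewrite expr0 mul1r; apply: le_trans (gcontent_gcube beta_gt0 a l0 p).
  by apply: le_gcontent => x [r rp [rx _]]; exact: (nest_sub l0 rp rx).
pose F : set D := [set r | nest r p /\ 18 * K < `|c r - c p|].
pose G := [set x | (gcube a l p `&` cube a l) x /\ 9 * K < `|f x - c p|].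
have K9 : 0 < 9 * K by rewrite mulr_gt0.
have s0 (q : D) : 0 < gside l q `^ beta by rewrite powR_gt0// gside_gt0.
have GH : (H G < (6^-1 * gside l p `^ beta)%:E)%E.
  apply: (le_lt_trans (osc pp0 K9)); rewrite lte_fin.
  have -> : K * gside l p `^ beta / (9 * K) = 9^-1 * gside l p `^ beta.
    by field; rewrite gt_eqF.
  by rewrite ltr_pM2r//; lra.
have [P GP PS] := cover_content_lt GH.
(* The whole cover weighs less than [p] does, so each of its members is smaller than [p]. *)
have Pp i : gside l (P i) < gside l p.
  rewrite ltNge; apply/negP => h.
  have : ((gside l p `^ beta)%:E <= \sum_(k <oo) (gside l (P k) `^ beta)%:E)%E.
    rewrite (@nneseriesD1 _ _ i xpredT)//=; last by move=> *; rewrite lee_fin powR_ge0.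
    rewrite -[leLHS]adde0 leeD//; last by apply: nneseries_ge0 => *;
      rewrite lee_fin powR_ge0.
    by rewrite lee_fin powR_le// ltW// gside_gt0.
  move=> /le_lt_trans/(_ PS); rewrite lte_fin; apply/negP; rewrite -leNgt.
  by have := s0 p; lra.
(* The parent of a maximal stopping cube is not a stopping cube, so its constant is within [18 * K]
   of [c p]; [mean_parent] bounds the last step. *)
have maxF q : maximal_in (R := R) F q -> `|c q - c p| <= jn_const * K.
  move=> [[qp big] maxq]; have [|r qr [rp rs]] := @nest_parent _ _ a l l0 q p qp.
    by move=> e; move: big; rewrite e subrr normr0; lra.
  have := mean_parent qr (nest_trans rp pp0) rs.
  have : `|c r - c p| <= 18 * K.
    rewrite leNgt; apply/negP => h; have rE : r = q by exact: (maxq r (conj rp h) qr).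
    by have := gside_gt0 l0 q; move: rs; rewrite rE; lra.
  have := ler_distD (c r) (c q) (c p); rewrite /jn_const; lra.
have := @stopping_cover _ _ _ beta_gt0 a l l0 F G P (excess j) ((2^-1) ^+ j)
  (excess j.+1 p) p.1.
have hM : 0 <= (2^-1 : R) ^+ j by rewrite exprn_ge0.
move=> /(_ hM) H1.
apply: le_trans (H1 _ _ GP _ _) _.
- by move=> q [[qp _] _].
(* Where [f] is within [9 * K] of [c q] it is more than [9 * K] away from [c p]. The remaining set
   has at most a ninth of the weight, so [G] fills at least half of [q]. *)
- move=> q [qp big]; have qp0 := nest_trans qp pp0.
  have := gcontent_nest_top (nest_trans qp0 p0_top).
  pose E := [set x | (gcube a l q `&` cube a l) x /\ 9 * K < `|f x - c q|].
  have sub : gcube a l q `&` cube a l `<=` (gcube a l q `&` G) `|` E.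
    move=> x [qx Qx]; have [h|h] := ltP (9 * K) `|f x - c q|; first by right.
    left; split=> //; split; first by split=> //; exact: (nest_sub l0 qp qx).
    have := ler_distD (f x) (c q) (c p); rewrite (distrC (c q) (f x)); lra.
  move=> /le_trans/(_ (le_gcontent _ _ _ sub)).
  move=> /le_trans/(_ (gcontentU beta_gt0 a l0 _ _)).
  move=> /le_trans/(_ (leeD (lexx _) (osc qp0 K9))).
  rewrite -leeBlDr// -EFinB; apply: le_trans; rewrite lee_fin.
  have -> : K * gside l q `^ beta / (9 * K) = 9^-1 * gside l q `^ beta.
    by field; rewrite gt_eqF.
  by have := s0 q; lra.
- move=> t [q maxq qt] tP; have [[qp big] maxq2] := maxq; apply: ih.
  apply: nest_trans pp0; case: tP => [[i tE]|[]//].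
  apply: (nest_meet l0 _ (nest_sub l0 qt (gcorner_in a l0 q)) (nest_sub l0 qp
    (gcorner_in a l0 q))).
  by rewrite -(gside_le l0) tE ltW.
- move=> x [r rp [rx big]].
  have jL : 18 * K <= j.+1%:R * jn_const * K.
    apply: ler_wpM2r; [exact: ltW|rewrite -(natr1 j) mulrDl mul1r].
    have := powR_ge0 2 beta; have : 0 <= j%:R * jn_const.
      by rewrite mulr_ge0// ltW// jn_const_gt0.
    by rewrite /jn_const; lra.
  have Fr : F r by split=> //; exact: le_lt_trans big.
  have Fp q : F q -> q.1 <= p.1 by move=> [[]].
  have [q maxq rq] := exists_maximal (R := R) Fp Fr.
  exists q => // t qt tP; have [[qp _] maxq2] := maxq.
  exists r; first exact: nest_trans qt.
  split=> //.
  have tp : nest t p.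
    case: tP => [[i tE]|->//].
    apply: (nest_meet l0 _ (nest_sub l0 qt (gcorner_in a l0 q)) (nest_sub l0 qp
      (gcorner_in a l0 q))).
    by rewrite -(gside_le l0) tE ltW.
  (* If [c t] is far from [c p], then [t] is a stopping cube containing [q], hence equal to [q].
     Either way one unit [jn_const * K] is used up, and the excess over [c t] is still of order
     [j]. *)
  have ct : `|c t - c p| <= jn_const * K.
    have [h|h] := leP `|c t - c p| (18 * K).
      by apply: le_trans h _; apply: ler_wpM2r; [exact: ltW|have := powR_ge0 2 beta;
        rewrite /jn_const; lra].
    by rewrite (maxq2 t) //; exact: maxF.
  have := ler_distD (c t) (c r) (c p); rewrite -(natr1 j) mulrDl mul1r mulrDl in big; lra.
apply: (@le_trans _ _ ((3 * (2^-1) ^+ j)%:E * (6^-1 * gside l p `^ beta)%:E)%E).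
  by apply: lee_wpmul2l; [rewrite lee_fin mulr_ge0|exact: ltW].
rewrite -EFinM lee_fin exprS; move: (_ ^+ j) hM (s0 p) => y y0 z0.
by rewrite le_eqVlt; apply/orP; left; apply/eqP; field.
Qed.

End john_nirenberg.

(** * Oscillation of the fractional maximal function *)
Section cubes.
Context {R : realType} {n : nat}.
Local Notation V := 'rV[R]_n.+1.
Implicit Types (a b : V) (l p : R).

Lemma cube_sub_le a p b l : 0 < p -> 0 < l -> cube a p `<=` cube b l -> p <= l.
Proof.
move=> p0 l0 sub; have : (lebesgue_outer (cube a p) <= lebesgue_outer (cube b l))%E.
  exact: le_cover_content.
by rewrite !lebesgue_outer_cube// lee_fin ler_pXn2r// nnegrE ltW.
Qed.

(** The cube, cut to side [l] when it is too large, is slid into [cube b l] one coordinate at a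
    time, losing no point of [cube b l]. *)
Lemma clip_cube b l a p : 0 < l -> 0 < p -> exists a',
  cube a' (Num.min p l) `<=` cube b l /\
  cube a p `&` cube b l `<=` cube a' (Num.min p l).
Proof.
move=> l0 p0; set m := Num.min p l.
have ml : m <= l by rewrite ge_min lexx orbT.
have mE : m = p \/ m = l by rewrite /m; case: leP; [left|right].
clearbody m.
exists (\row_i Num.max (b 0 i) (Num.min (a 0 i) (b 0 i + l - m))); split=> x.
  move=> xa i; have := xa i; rewrite mxE.
  by case: (leP (a 0 i)) => h1; case: (leP (b 0 i)) => h2 /andP[h3 h4];
    apply/andP; split; lra.
move=> [xa xb] i; have := xa i; have := xb i; rewrite mxE => /andP[h1 h2] /andP[h3 h4].
by case: (leP (a 0 i)) => h5; case: (leP (b 0 i)) => h6; case: mE => mE;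
  apply/andP; split; lra.
Qed.

Lemma cube_union_sub a p b s x : 0 < p -> 0 < s -> cube a p x -> cube b s x ->
  exists a', cube a p `|` cube b s `<=` cube a' (p + s).
Proof.
move=> p0 s0 xa xb; exists (\row_i Num.min (a 0 i) (b 0 i)).
move=> y yab i; have /andP[h1 h2] := xa i; have /andP[h3 h4] := xb i; rewrite mxE.
have : (a 0 i < y 0 i < a 0 i + p) \/ (b 0 i < y 0 i < b 0 i + s).
  by case: yab => /(_ i); [left|right].
case: (leP (a 0 i)) => h5 [] /andP[h6 h7]; apply/andP; split; lra.
Qed.

End cubes.

(** Compares integrals [x] and [y] over cubes of volumes [P] and [M] through a common constant
    [c]. *)
Lemma quotient_le {R : realFieldType} (x y c P M u v : R) : 0 < P -> 0 < M ->
  x <= c * P + u * P -> c * M <= y + v * M -> x / P <= y / M + (u + v).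
Proof.
move=> P0 M0 h1 h2; have : x / P <= c + u by rewrite ler_pdivrMr// mulrDl.
have : c - v <= y / M by rewrite ler_pdivlMr// mulrBl; lra.
by lra.
Qed.

Lemma bernoulli_le {R : realFieldType} (y : R) (m : nat) : 0 <= y <= 1 ->
  1 - m%:R * (1 - y) <= y ^+ m.
Proof.
move=> /andP[y0 y1]; elim: m => [|m ih]; first by rewrite expr0; lra.
rewrite exprS -natr1.
have : 0 <= y ^+ m <= 1 by rewrite exprn_ge0// exprn_ile1.
move: (y ^+ m) ih => z h1 /andP[z0 z1].
have : 0 <= (1 - y) * (1 - z) by rewrite mulr_ge0; lra.
by move: (m%:R) h1 => k h1; lra.
Qed.

Section local_oscillation.
Context {R : realType} {n : nat}.
Variables (alpha beta : R).
Hypothesis beta_gt0 : 0 < beta.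
Hypothesis beta_le : beta <= n.+1%:R.
Hypothesis alpha_ge0 : 0 <= alpha.
Hypothesis alpha_lt : alpha < beta.
Variables (a : 'rV[R]_n.+1) (l : R).
Hypothesis l0 : 0 < l.
Local Notation D := (int * 'rV[int]_n.+1)%type.
Local Notation V := 'rV[R]_n.+1.
Local Notation N := n.+1.
Local Notation nest := (@nest R n).
Local Notation top := (@top_index n).
Local Notation H := (gcontent beta a l).
Implicit Types (q r : D) (x y b : V) (p s : R).
Variables (f : V -> R) (J : V -> R -> R).
Hypothesis J_ge0 : forall b p, 0 <= J b p.
Hypothesis J_le : forall b p b' p',
  cube b p `&` cube a l `<=` cube b' p' -> J b p <= J b' p'.

Definition fmean b p : R := p `^ (- (N%:R - alpha)) * J b p.

Definition fmax x : \bar R :=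
  ereal_sup [set s | exists b p, [/\ 0 < p, cube b p x & s = (fmean b p)%:E]].

Lemma fmean_ge0 b p : 0 <= fmean b p.
Proof. by rewrite mulr_ge0// powR_ge0. Qed.

Lemma fmean_fmax b p x : 0 < p -> cube b p x -> ((fmean b p)%:E <= fmax x)%E.
Proof. by move=> p0 bx; apply: ereal_sup_ubound; exists b, p. Qed.

Lemma exponent_ge0 : 0 <= N%:R - alpha.
Proof. by rewrite subr_ge0; apply: le_trans beta_le; exact: ltW. Qed.

Lemma fweight_le p s : 0 < p -> p <= s ->
  s `^ (- (N%:R - alpha)) <= p `^ (- (N%:R - alpha)).
Proof.
move=> p0 ps; rewrite !powRN lef_pV2 ?posrE ?powR_gt0//; last exact: lt_le_trans ps.
by apply: powR_le => //; [exact: exponent_ge0|exact: ltW].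
Qed.

(** Separates the ordinary mean, governed by the oscillation, from a factor increasing in [p]. *)
Lemma fmeanE b p : 0 < p -> fmean b p = p `^ alpha * (J b p / p ^+ N).
Proof.
move=> p0; rewrite /fmean opprB powRB; last by rewrite (gt_eqF p0) implybT.
by rewrite powR_mulrn ?(ltW p0)// mulrAC mulrA.
Qed.

(** [J_le] encodes that the function vanishes outside [cube a l]: clipping a cube does not decrease
    its integral and does not enlarge its side, so subcubes of [cube a l] suffice. *)
Lemma fmax_le x (z : R) : cube a l x ->
  (forall b p, 0 < p -> cube b p x -> cube b p `<=` cube a l -> fmean b p <= z) ->
  (fmax x <= z%:E)%E.
Proof.
move=> ax h; apply: ge_ereal_sup => _ [b [p [p0 bx ->]]].
have [b' [b'a bb']] := clip_cube a b l0 p0.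
have m0 : 0 < Num.min p l by rewrite lt_min p0.
rewrite lee_fin; apply: le_trans (h b' _ m0 (bb' _ _) b'a) => //.
by apply: ler_pM; rewrite ?powR_ge0//; [rewrite fweight_le// ge_min lexx|exact: J_le].
Qed.

Lemma fmean_large (delta s : R) b p b' m : 0 < delta -> delta <= p ->
  p <= m -> m <= p + s -> J b p <= J b' m ->
  fmean b p <= fmean b' m +
    N%:R * s / delta * (delta `^ (- (N%:R - alpha)) * J a l).
Proof.
move=> d0 dp pm ms Jp; pose e := N%:R - alpha; pose y := p / m.
have p0 : 0 < p by lra.
have m0 : 0 < m by lra.
have y0 : 0 < y by rewrite divr_gt0.
have y1 : y <= 1 by rewrite ler_pdivrMr// mul1r.
have mE : m `^ (- e) = p `^ (- e) * y `^ e.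
  have -> : p = m * y by rewrite mulrC divfK// gt_eqF.
  rewrite powRM ?(ltW m0) ?(ltW y0)// -mulrA -powRD; last by rewrite (gt_eqF y0) implybT.
  by rewrite addNr powRr0 mulr1.
have ye : 1 - N%:R * s / delta <= y `^ e.
  apply: (@le_trans _ _ (y ^+ N)).
    apply: le_trans (@bernoulli_le _ y N _); last by rewrite y1 ltW.
    rewrite lerD2l lerN2 -mulrA ler_wpM2l//.
    have -> : 1 - y = (m - p) / m by rewrite mulrBl divff// gt_eqF.
    by apply: ler_pM; rewrite ?subr_ge0 ?invr_ge0 ?(ltW m0) ?lef_pV2 ?posrE//; lra.
  rewrite -powR_mulrn ?(ltW y0)//; apply: ger_powR; first by rewrite y0.
  by rewrite /e gerBl.
pose B := p `^ (- e) * J b p.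
have B0 : 0 <= B by rewrite mulr_ge0// powR_ge0.
have BB : B <= delta `^ (- e) * J a l.
  apply: ler_pM; rewrite ?powR_ge0//; first exact: fweight_le.
  by apply: J_le => z [].
apply: (@le_trans _ _ (y `^ e * B + N%:R * s / delta * B)).
  by rewrite -mulrDl ler_peMl// -lerBlDr.
have s0 : 0 <= s by lra.
apply: lerD; last by rewrite ler_wpM2l// mulr_ge0 ?invr_ge0 ?(ltW d0)// mulr_ge0.
rewrite /fmean -/e mE /B mulrCA -mulrA ler_wpM2l ?powR_ge0//.
by rewrite ler_wpM2l ?powR_ge0.
Qed.

Variables (w rho : R).
Hypothesis w0 : 0 < w.
Hypothesis rho0 : 0 < rho.

(* [J b p] stands for the integral of [|f|] over [cube b p], so that the last two
   inequalities say that [|f|] differs from [|c|] by at most [w * p ^+ N] in mean. *)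
Definition controlled_osc := forall b p, 0 < p -> p <= rho -> cube b p `<=` cube a l ->
  exists c : R,
    (forall t : R, 0 < t -> (H [set x | cube b p x /\ (t < `|f x - c|)%R] <=
                            (w * p `^ beta / t)%:E)%E) /\
    (forall b' p', 0 < p' -> cube b' p' `<=` cube b p ->
      J b' p' <= `|c| * p' ^+ N + w * p ^+ N /\
      `|c| * p' ^+ N <= J b' p' + w * p ^+ N).

Hypothesis osc : controlled_osc.

(** The side of the threefold enlargement of a grid cube after clipping it to [cube a l]. *)
Definition star_side q : R := Num.min (3 * gside l q) l.

Lemma star_side_gt0 q : 0 < star_side q.
Proof. by rewrite lt_min l0 mulr_gt0// gside_gt0. Qed.

Lemma star_side_ge q : nest q top -> gside l q <= star_side q.
Proof.
move=> qt; rewrite le_min; have := gside_gt0 l0 q; have := nest_side l0 qt.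
by rewrite {2}/gside expr0z mulr1 => h1 h2; apply/andP; split; lra.
Qed.

Lemma star_side_nest q r : nest q r -> star_side q <= star_side r.
Proof.
move=> qr; rewrite le_min !ge_min lexx orbT andbT ler_pM2l//.
by rewrite (nest_side l0 qr).
Qed.

Lemma exists_star q : nest q top -> exists b, [/\
  cube b (star_side q) `<=` cube a l,
  gcube a l q `&` cube a l `<=` cube b (star_side q) &
  forall b' p x, 0 < p -> p <= gside l q -> cube b' p `<=` cube a l ->
    gcube a l q x -> cube b' p x -> cube b' p `<=` cube b (star_side q)].
Proof.
move=> qt; have s0 := gside_gt0 l0 q.
have s30 : 0 < 3 * gside l q by rewrite mulr_gt0.
have [b [ba bs]] := clip_cube a (gcorner a l q - const_mx (gside l q)) l0 s30.
exists b; split=> //.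
  apply: subset_trans bs; apply: setSI; exact: hcube_sub_cube.
move=> b' p x p0 pq b'a qx b'x; apply: subset_trans bs => y b'y; split; last exact: b'a.
move=> i; have := qx i; have := b'x i; have := b'y i; rewrite !mxE.
by move=> /andP[h1 h2] /andP[h3 h4] /andP[h5 h6]; apply/andP; split; lra.
Qed.

(** A near-optimal constant on the enlarged cube rather than a median proper. The clauses serve the
    John-Nirenberg inequality, upper bounds for integrals over small cubes meeting [q], and a lower
    bound for the integral over one larger cube containing them. *)
Definition median q (c : R) : Prop :=
  [/\ forall t, 0 < t ->
       (H [set x | (gcube a l q `&` cube a l) x /\ (t < `|f x - c|)%R] <=
         (3 `^ beta * w * gside l q `^ beta / t)%:E)%E,
      forall b p x, 0 < p -> p <= gside l q -> cube b p `<=` cube a l ->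
        gcube a l q x -> cube b p x ->
        J b p <= `|c| * p ^+ N + w * (3 * gside l q) ^+ N &
      exists b, [/\ cube b (star_side q) `<=` cube a l,
        `|c| * star_side q ^+ N <= J b (star_side q) + w * (3 * gside l q) ^+ N &
        forall b' p x, 0 < p -> p <= gside l q -> cube b' p `<=` cube a l ->
          gcube a l q x -> cube b' p x -> cube b' p `<=` cube b (star_side q)]].

Lemma exists_medians : exists c : D -> R,
  forall q, nest q top -> star_side q <= rho -> median q (c q).
Proof.
suff h q : exists c : R, nest q top -> star_side q <= rho -> median q c.
  by have [c cP] := choice h; exists c.
have [qt|nqt] := pselect (nest q top); last by exists 0.
have [qr|] := leP (star_side q) rho; last by exists 0.
have [b [ba qb bmax]] := exists_star qt.
have [c [c1 c2]] := osc (star_side_gt0 q) qr ba.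
have s0 := gside_gt0 l0 q; have S0 := star_side_gt0 q.
have S3 : star_side q <= 3 * gside l q by rewrite ge_min lexx.
have SN : w * star_side q ^+ N <= w * (3 * gside l q) ^+ N.
  by rewrite ler_pM2l// lerXn2r// nnegrE ltW// mulr_gt0.
exists c => _ _; split.
- move=> t t0; apply: (le_trans _ (le_trans (c1 t t0) _)).
    by apply: le_gcontent => x [[qx ax] tx]; split=> //; exact: qb.
  rewrite lee_fin ler_pM2r ?invr_gt0// [_ * w]mulrC -mulrA ler_pM2l//.
  by rewrite -powRM ?(ltW s0)//; apply: powR_le => //; exact: ltW.
- move=> b' p x p0 pq b'a qx b'x.
  by have [+ _] := c2 b' p p0 (bmax _ _ _ p0 pq b'a qx b'x); lra.
- exists b; split=> //.
  by have [_ +] := c2 b (star_side q) S0 (@subset_refl _ _); lra.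
Qed.

(** [l]^ alpha[bounds the fractional factor,]6 ^+ N[compares volumes of cubes with enlarged grid
    cubes, once for each of the two means, and the last term is one John-Nirenberg unit for]K = 3
    [^ beta * w]. *)
Definition osc_const : R := l `^ alpha * (2 * 6 ^+ N + jn_const beta * 3 `^ beta).

Lemma fmean_medium b p b' p' (z : R) : 0 < p -> p <= p' -> p' <= l ->
  J b p / p ^+ N <= J b' p' / p' ^+ N + z -> 0 <= z ->
  fmean b p <= fmean b' p' + l `^ alpha * z.
Proof.
move=> p0 pp' p'l h z0; have p'0 := lt_le_trans p0 pp'.
rewrite !fmeanE//; apply: (@le_trans _ _ (p' `^ alpha * (J b' p' / p' ^+ N + z))).
  apply: ler_pM => //; first exact: powR_ge0.
    by rewrite divr_ge0// exprn_ge0// ltW.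
  by apply: powR_le => //; exact: ltW.
rewrite mulrDr lerD2l ler_wpM2r//; apply: powR_le => //; exact: ltW.
Qed.

Lemma local_osc b s (tau : R) : 0 < s -> Num.min (6 * s) l <= rho ->
  cube b s `<=` cube a l ->
  osc_const * w + N%:R * s / (rho / 2) * ((rho / 2) `^ (- (N%:R - alpha)) * J a l) <=
    tau ->
  exists G : R, [/\ 0 <= G, forall x, cube b s x -> (G%:E <= fmax x)%E &
    forall j : nat, (H [set x | cube b s x /\ ((G + tau * j.+1%:R)%:E < fmax x)%E] <=
      (@grid_const R n beta * (2^-1) ^+ j * s `^ beta)%:E)%E].
Proof.
move=> s0 srho ba hostau.
have sl : s <= l := cube_sub_le s0 l0 ba.
(* [G] will be the supremum of the means over subcubes of [cube a l] containing [cube b s]. It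
   bounds the maximal function from below on [cube b s], so only the excess above it needs an
   estimate. *)
pose T : set R := [set z | exists b' p, [/\ 0 < p, cube b' p `<=` cube a l,
  cube b s `<=` cube b' p & z = fmean b' p]].
have Tb : T (fmean b s) by exists b, s; split=> //; exact: subset_refl.
have Tub : ubound T (s `^ (- (N%:R - alpha)) * J a l).
  move=> _ [b' [p [p0 b'a bb' ->]]]; apply: ler_pM; rewrite ?powR_ge0//.
    by apply: fweight_le => //; exact: cube_sub_le bb'.
  by apply: J_le => x [/b'a].
have supT : has_sup T by split;
  [exists (fmean b s)|exists (s `^ (- (N%:R - alpha)) * J a l)].
have TG b' p : 0 < p -> cube b' p `<=` cube a l -> cube b s `<=` cube b' p ->
    fmean b' p <= sup T.
  by move=> p0 b'a bb'; apply: sup_upper_bound => //; exists b', p.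
exists (sup T); split.
- by apply: le_trans (fmean_ge0 b s) _; exact: TG.
- move=> x bx; rewrite -(ereal_sup_EFin supT.2 supT.1);
  apply: ge_ereal_sup => _ [_ [b' [p [p0 b'a bb' ->]]] <-].
  by apply: fmean_fmax => //; exact: bb'.
move=> j; have [q bq qs] := hcube_cover a l0 b s0.
have [c cP] := exists_medians.
pose K := 3 `^ beta * w; have K0 : 0 < K by rewrite mulr_gt0// powR_gt0.
have star_rho d : star_side (q d) <= rho.
  apply: le_trans srho; rewrite le_min !ge_min lexx orbT andbT.
  by apply/orP; left; have /andP[_] := qs d; lra.
have q_l d r : nest r (q d) -> star_side r <= rho.
  by move=> rq; apply: le_trans (star_rho d); exact: star_side_nest.
pose A d := if `[< nest (q d) top >] then excess beta a l c K j (q d) else set0.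
have HA d : (H (A d) <= ((2^-1) ^+ j * (2 * s) `^ beta)%:E)%E.
  have J0 : 0 <= (2^-1 : R) ^+ j by rewrite exprn_ge0.
  rewrite /A; case: asboolP => qt;
    last by rewrite gcontent0// lee_fin mulr_ge0// powR_ge0.
  apply: le_trans (john_nirenberg beta_gt0 beta_le l0 K0 qt _ j (nest_refl _)) _.
    by move=> r t rq t0; have [+ _ _] := cP r (nest_trans rq qt) (q_l d r rq); exact.
  rewrite lee_fin ler_wpM2l//; have /andP[_ h] := qs d.
  by apply: powR_le; rewrite ltW// gside_gt0.
apply: (@le_trans _ _ (H (\bigcup_d A d))); last first.
  apply: le_trans (gcontent_bigcup beta_gt0 a l0 _) _.
  apply: (@le_trans _ _ (\sum_(d : {ffun 'I_n.+1 -> bool}) ((2^-1) ^+ j * (2 * s) `^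
    beta)%:E)%E).
    by apply: lee_sum => d _; exact: HA.
  rewrite sumEFin sumr_const card_ffun card_bool card_ord lee_fin.
  rewrite powRM ?ler0n ?(ltW s0)// -(mulr_natl _ (2 ^ n.+1)) natrX.
  by rewrite /grid_const le_eqVlt; apply/orP; left; apply/eqP; ring.
apply: le_gcontent => x [bx big]; apply: contrapT => xA.
move: big; apply/negP; rewrite -leNgt.
have sN : 0 <= N%:R * s / (rho / 2) by rewrite !mulr_ge0 ?invr_ge0 ?divr_ge0 ?(ltW s0)
  ?(ltW rho0).
have wJ0 : 0 <= (rho / 2) `^ (- (N%:R - alpha)) * J a l by rewrite mulr_ge0 ?powR_ge0.
have la0 : 0 <= l `^ alpha by exact: powR_ge0.
have L0 : 0 < jn_const beta :> R by exact: jn_const_gt0.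
have Bw0 : 0 <= N%:R * s / (rho / 2) * ((rho / 2) `^ (- (N%:R - alpha)) * J a l).
  by rewrite mulr_ge0.
have osc0 : 0 <= osc_const * w.
  rewrite mulr_ge0 ?(ltW w0)// mulr_ge0//.
  by rewrite addr_ge0// mulr_ge0 ?exprn_ge0 ?powR_ge0 ?(ltW L0).
have tau0 : 0 <= tau by apply: le_trans hostau; rewrite addr_ge0.
have tauj : tau <= tau * j.+1%:R by rewrite ler_peMr// ler1n.
apply: fmax_le => [|b' p p0 b'x b'a]; first exact: ba.
have pl : p <= l := cube_sub_le p0 l0 b'a.
(* A cube with [s <= p] is compared with a clipped enlargement containing [cube b s]; smaller cubes
   are reached through a chain of grid cubes. *)
have [sp|ps] := leP s p.
  have [b1 b1sub] := cube_union_sub p0 s0 b'x bx.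
  have ps0 : 0 < p + s by rewrite addr_gt0.
  have [b2 [b2a b12]] := clip_cube a b1 l0 ps0.
  set m := Num.min (p + s) l in b2a b12.
  have m0 : 0 < m by rewrite lt_min ps0.
  have pm : p <= m by rewrite le_min pl andbT lerDl ltW.
  have ml : m <= l by rewrite ge_min lexx orbT.
  have mps : m <= p + s by rewrite ge_min lexx.
  have b'2 : cube b' p `<=` cube b2 m.
    by move=> y yb; apply: b12; split; [apply: b1sub; left|exact: b'a].
  have GT : fmean b2 m <= sup T.
    apply: TG => // y yb; apply: b12; split; [by apply: b1sub; right|exact: ba].
  have [mrho|rhom] := leP m rho.
    have [c' [_ c'P]] := osc m0 mrho b2a.
    have [h1 _] := c'P b' p p0 b'2.
    have [_ h2] := c'P b2 m m0 (@subset_refl _ _).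
    have oscw : l `^ alpha * (w * (2 ^+ N + 1)) <= osc_const * w.
      rewrite -mulrA ler_wpM2l// mulrC ler_wpM2r ?(ltW w0)//.
      have : 1 <= 6 ^+ N :> R by rewrite exprn_ege1// ler1n.
      have : 2 ^+ N <= 6 ^+ N :> R by rewrite lerXn2r// ?nnegrE; lra.
      have : 0 <= jn_const beta * 3 `^ beta by rewrite mulr_ge0 ?(ltW L0) ?powR_ge0.
      by lra.
    suff : fmean b' p <= fmean b2 m + l `^ alpha * (w * (2 ^+ N + 1)).
      by move=> h; lra.
    apply: fmean_medium => //.
      rewrite mulrDr mulr1; apply: (quotient_le (c := `|c'|)); rewrite ?exprn_gt0//.
      apply: le_trans h1 _; rewrite lerD2l -mulrA -exprMn ler_wpM2l ?(ltW w0)//.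
      by rewrite lerXn2r// ?nnegrE; lra.
    by rewrite mulr_ge0 ?(ltW w0)// addr_ge0 ?exprn_ge0.
  have Jp : J b' p <= J b2 m by apply: J_le => y [yb _]; exact: b'2.
  (* Here [rho < m <= p + s <= 2 * p]. *)
  have rhoE : rho / 2 <= p by lra.
  have rho2 : 0 < rho / 2 by rewrite divr_gt0.
  have := fmean_large (b := b') (b' := b2) (s := s) rho2 rhoE pm _ Jp; lra.
have [d _ qdx] := bq x (cube_sub_hcube bx).
have /andP[qs1 qs2] := qs d.
have qdt : nest (q d) top by apply: (nest_top l0 _ (ba _ bx) qdx); lra.
(* A grid cube [r] at [x] of side comparable to [p]; since [p < s] it lies in the grid cube [q d] of
   side comparable to [s]. *)
have [k kp] := exists_level l0 p0.
have [m rx] := gcube_exists a l0 k x.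
pose r : D := (k, m).
have /andP[pr rp] := kp.
have rq : nest r (q d).
  by apply: (nest_meet l0 _ rx qdx); apply: (gside_lt_double l0);
    rewrite /gside/= in qs1 *; lra.
have [_ r2 _] := cP r (nest_trans rq qdt) (q_l d r rq).
have [_ _ [b2 [b2a b2c b2max]]] := cP (q d) qdt (star_rho d).
have Jr := r2 b' p x p0 pr b'a rx b'x.
have sS := star_side_ge qdt.
have S0 := star_side_gt0 (q d).
have GT : fmean b2 (star_side (q d)) <= sup T.
  apply: TG => //; exact: (b2max b s x s0 qs1 ba qdx bx).
(* Because [x] avoids the excess sets, all constants along the chain at [x] stay within [j] units of
   [c (q d)]. *)
have cc : `|c r - c (q d)| <= j%:R * jn_const beta * K.
  rewrite leNgt; apply/negP => h; apply: xA; exists d => //.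
  rewrite /A; case: asboolP => // _; exists r => //.
suff : fmean b' p <= fmean b2 (star_side (q d)) +
    l `^ alpha * (w * (2 * 6 ^+ N) + j%:R * jn_const beta * K).
  move=> /le_trans; apply; apply: lerD => //.
  apply: (@le_trans _ _ (osc_const * w * j.+1%:R)); last first.
    by rewrite ler_wpM2r//; lra.
  rewrite /osc_const /K -natr1 -!mulrA ler_wpM2l//.
  have : 0 <= w * 6 ^+ N * j%:R by rewrite !mulr_ge0 ?exprn_ge0 ?(ltW w0).
  have : 0 <= jn_const beta * 3 `^ beta * w by rewrite !mulr_ge0 ?powR_ge0 ?(ltW w0)
    ?(ltW L0).
  by lra.
apply: fmean_medium => //.
- by lra.
- by rewrite ge_min lexx orbT.
- set jL := j%:R * _ * K in cc *.
  have -> : w * (2 * 6 ^+ N) + jL = w * 6 ^+ N + (w * 6 ^+ N + jL) by ring.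
  apply: (quotient_le (c := `|c r|)); rewrite ?exprn_gt0//.
    apply: le_trans Jr _; rewrite lerD2l -mulrA -exprMn ler_wpM2l ?(ltW w0)//.
    by rewrite lerXn2r// ?nnegrE /gside/=; lra.
  rewrite mulrDl.
  have h1 : w * (3 * gside l (q d)) ^+ N <= w * 6 ^+ N * star_side (q d) ^+ N.
    rewrite -mulrA -exprMn ler_wpM2l ?(ltW w0)// lerXn2r// ?nnegrE; lra.
  have h2 : `|c r| * star_side (q d) ^+ N <= `|c (q d)| * star_side (q d) ^+ N +
      jL * star_side (q d) ^+ N.
    rewrite -mulrDl ler_wpM2r ?exprn_ge0 ?(ltW S0)//.
    by have := ler_distD 0 (c r) (c (q d)); have := lerB_dist (c r) (c (q d)); lra.
  by lra.
by rewrite addr_ge0 ?mulr_ge0 ?(ltW w0) ?(ltW L0) ?(ltW K0).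
Qed.

End local_oscillation.

(** * Quasicontinuity of the fractional maximal function *)
Section row_topology.
Context {R : realType} {n : nat}.
Local Notation V := 'rV[R]_n.+1.
Implicit Types (x y b : V).

Definition row_close (r : R) x y : Prop := forall i, `|x 0 i - y 0 i| < r.

Lemma nbhs_rowP x (A : set V) :
  nbhs x A <-> exists2 r : R, 0 < r & forall y, row_close r x y -> A y.
Proof.
split=> [/nbhs_ballP[r r0 h]|[r r0 h]]; [|apply/nbhs_ballP]; exists r => // y xy.
  by apply: h; split=> // i j; rewrite !ord1; exact: xy.
by apply: h => i; case: xy => _; exact.
Qed.

Lemma open_cube b (s : R) : open (cube b s).
Proof.
rewrite openE => x bx.
exists (fun _ j => [set t : R | b 0 j < t < b 0 j + s]) => [i j|y by_ i]; last exact: by_.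
have /andP[h1 h2] := bx j; rewrite !ord1.
near=> t => /=; apply/andP; split; near: t.
  by apply: lt_nbhsr.
by apply: lt_nbhsl.
Unshelve. all: by end_near. Qed.

Lemma cube_close b (s : R) x : cube b s x ->
  exists2 r : R, 0 < r & forall y, row_close r x y -> cube b s y.
Proof. by move=> bx; apply/nbhs_rowP;
  exact: (open_nbhs_nbhs (conj (@open_cube b s) bx)). Qed.

End row_topology.

Section fmax_continuity.
Context {R : realType} {n : nat}.
Variables (alpha beta : R).
Hypothesis beta_gt0 : 0 < beta.
Hypothesis beta_le : beta <= n.+1%:R.
Hypothesis alpha_ge0 : 0 <= alpha.
Hypothesis alpha_lt : alpha < beta.
Variables (a : 'rV[R]_n.+1) (l : R).
Hypothesis l0 : 0 < l.
Local Notation D := (int * 'rV[int]_n.+1)%type.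
Local Notation V := 'rV[R]_n.+1.
Local Notation N := n.+1.
Local Notation nest := (@nest R n).
Local Notation top := (@top_index n).
Local Notation H := (gcontent beta a l).
Implicit Types (q r : D) (x y b : V) (p s : R).
Variables (f : V -> R) (J : V -> R -> R).
Hypothesis J_ge0 : forall b p, 0 <= J b p.
Hypothesis J_le : forall b p b' p',
  cube b p `&` cube a l `<=` cube b' p' -> J b p <= J b' p'.
Local Notation fmax := (fmax alpha J).
Local Notation fmean := (@fmean _ n alpha J).

Variable O : set V.

Definition thin_at x := forall q, nest q top -> gcube a l q x ->
  (H (gcube a l q `&` O) < (2^-1 * gside l q `^ beta)%:E)%E.

Definition exceptional_const : R := 1 + 4 * (@grid_const R n beta * 3 `^ beta).

Lemma exists_exceptional (e : R) : 0 < e -> open O -> O `<=` cube a l ->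
  (H O < e%:E)%E -> exists U, [/\ open U, O `<=` U, U `<=` cube a l,
    (H U <= (exceptional_const * e)%:E)%E & (cube a l `\` U) `<=` thin_at].
Proof.
move=> e0 oO Oa Oe; have [P OP Pe] := cover_content_lt Oe.
pose F : set D := [set q | nest q top /\
  ((2^-1 * gside l q `^ beta)%:E <= H (gcube a l q `&` O))%E].
pose B := \bigcup_(q in F) gcube a l q.
have Ftop q : F q -> q.1 <= top.1 by move=> [[]].
(* [stopping_cover] with [X] the grid cubes themselves gives the factor 3; the slack up to 4 makes
   room for a strict inequality. *)
have HB : (H B < (4 * e)%:E)%E.
  have := @stopping_cover _ _ _ beta_gt0 a l l0 F O P (gcube a l) 1 B top.1 ler01 Ftop.
  move=> /(_ _ OP) h; apply: (le_lt_trans (h _ _ _)).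
  - by move=> q [].
  - by move=> t _ _; rewrite mul1r; exact: gcontent_gcube.
  - move=> x [q Fq qx]; have [p maxp qp] := exists_maximal (R := R) Ftop Fq.
    by exists p => // t pt _; exact: (nest_sub l0 (nest_trans qp pt)).
  apply: (@le_lt_trans _ _ (3%:E * e%:E)%E).
    by rewrite mulr1; apply: lee_wpmul2l; [rewrite lee_fin|exact: ltW].
  by rewrite -EFinM lte_fin; lra.
have [T BT Te] := cover_content_lt HB.
(* Tripling turns the half-open covering cubes into open ones, so that [U] is open. *)
pose W i := cube (gcorner a l (T i) - const_mx (gside l (T i))) (3 * gside l (T i)).
exists (O `|` (\bigcup_i W i `&` cube a l)); split.
- apply: openU => //; apply: openI; last exact: open_cube.
  by apply: bigcup_open => i _; exact: open_cube.
- by move=> x; left.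
- by move=> x [/Oa//|[]].
- apply: (le_trans (gcontentU beta_gt0 a l0 _ _)).
  rewrite /exceptional_const mulrDl mul1r EFinD; apply: leeD; first exact: ltW.
  apply: (@le_trans _ _ (H (\bigcup_i W i))); first by apply: le_gcontent => x [].
  apply: (le_trans (gcontent_bigcup_nat beta a l _)).
  apply: (@le_trans _ _ ((@grid_const R n beta * 3 `^ beta)%:E *
      \sum_(i <oo) (gside l (T i) `^ beta)%:E)%E).
    rewrite -nneseriesZl; last by move=> i _; rewrite lee_fin powR_ge0.
    apply: lee_nneseries => i _; first by move=> _; exact: gcontent_ge0.
    have s0 := gside_gt0 l0 (T i).
    apply: (le_trans (gcontent_cube beta_gt0 a l0 _ _)); first by rewrite mulr_gt0.
    by rewrite powRM ?ler0n ?(ltW s0)// mulrA -EFinM.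
  apply: (@le_trans _ _ ((@grid_const R n beta * 3 `^ beta)%:E * (4 * e)%:E)%E).
    apply: lee_wpmul2l; last exact: ltW.
    by rewrite lee_fin mulr_ge0 ?powR_ge0// ltW// grid_const_gt0.
  by rewrite -EFinM lee_fin; lra.
- move=> x [ax nUx] q qt qx; rewrite ltNge; apply/negP => h; apply: nUx; right.
  split=> //; have [i _ Tx] := BT x (ex_intro2 _ _ q (conj qt h) qx).
  by exists i => //; apply: hcube_sub_cube Tx; exact: gside_gt0.
Qed.

Variable U : set V.
Hypothesis OU : O `<=` U.
Hypothesis U_thin : (cube a l `\` U) `<=` thin_at.
Hypothesis f_cont : forall x, (cube a l `\` O) x -> forall e : R, 0 < e ->
  exists2 r : R, 0 < r & forall y, (cube a l `\` O) y -> row_close r x y ->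
    `|f x - f y| < e.
Hypothesis f_osc : forall w : R, 0 < w -> exists2 rho : R, 0 < rho &
  controlled_osc beta a l f J w rho.

Definition value_const : R := 3 * 3 `^ beta + 6 ^+ N.

Lemma value_const_gt0 : 0 < value_const.
Proof. by rewrite addr_gt0 ?exprn_gt0 ?mulr_gt0 ?powR_gt0. Qed.

(** In a grid cube at [x], [O] takes less than half of the weight and the set where [f] is far from
    the constant at most a third. A point [y] remains at which [f] is close to the constant, and
    thus to the means in question. *)
Lemma near_value (w rho : R) : 0 < w -> 0 < rho -> controlled_osc beta a l f J w rho ->
  forall x p, (cube a l `\` U) x -> 0 < p -> p <= l -> 6 * p <= rho ->
  exists y, [/\ (cube a l `\` O) y, row_close (2 * p) x y,
    forall b, cube b p x -> cube b p `<=` cube a l ->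
      J b p / p ^+ N <= `|f y| + value_const * w &
    exists b s, [/\ p <= s, s <= l, cube b s x, cube b s `<=` cube a l &
      `|f y| - value_const * w <= J b s / s ^+ N]].
Proof.
move=> w0 rho0 osc x p [ax nUx] p0 pl prho.
have [c cP] := exists_medians beta_gt0 l0 w0 osc.
have [r [rx /andP[pr rp]]] := exists_gcube a l0 x p0.
have rt : nest r top by apply: (nest_top l0 _ ax rx); lra.
have s0 := gside_gt0 l0 r.
have [|c1 c2 [b [ba cb bmax]]] := cP r rt.
  by apply: (le_trans _ prho); rewrite ge_min; apply/orP; left; lra.
(* Chosen so that the weak-type bound equals a third of the weight of [r]. *)
pose t : R := 3 * 3 `^ beta * w.
have t0 : 0 < t by rewrite !mulr_gt0// powR_gt0.
have z0 : 0 < gside l r `^ beta by rewrite powR_gt0.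
have [y [[ry ay] [nOy yt]]] : exists y, (gcube a l r `&` cube a l) y /\
    ~ O y /\ `|f y - c r| <= t.
  apply: contrapT => none.
  have sub : gcube a l r `&` cube a l `<=` (gcube a l r `&` O) `|`
      [set y | (gcube a l r `&` cube a l) y /\ t < `|f y - c r|].
    move=> y [ry ay]; have [Oy|nOy] := pselect (O y); first by left.
    right; split=> //; rewrite ltNge; apply/negP => yt.
    by apply: none; exists y.
  have := gcontent_nest_top beta_gt0 beta_le a l0 rt; apply/negP; rewrite -ltNge.
  apply: (le_lt_trans (le_gcontent _ _ _ sub)).
  apply: (le_lt_trans (gcontentU beta_gt0 a l0 _ _)).
  apply: (@le_lt_trans _ _ ((2^-1 * gside l r `^ beta)%:E + (3^-1 * gside l r `^
    beta)%:E)%E).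
    apply: leeD; first exact/ltW/(U_thin (conj ax nUx) rt rx).
    apply: (le_trans (c1 t t0)); rewrite lee_fin /t le_eqVlt; apply/orP; left.
    by apply/eqP; field; rewrite !gt_eqF// powR_gt0.
  by rewrite -EFinD lte_fin; lra.
have six : 0 <= 6 ^+ N * w by rewrite mulr_ge0 ?exprn_ge0 ?(ltW w0).
exists y; split=> //.
- move=> i; have /andP[h1 h2] := rx i; have /andP[h3 h4] := ry i.
  by rewrite ltr_norml; apply/andP; split; lra.
- move=> b' b'x b'a; have := c2 b' p x p0 pr b'a rx b'x.
  rewrite ler_pdivrMr ?exprn_gt0// mulrDl => /le_trans; apply.
  apply: (@le_trans _ _ ((`|f y| + t) * p ^+ N + w * (6 ^+ N * p ^+ N))).
    apply: lerD.
      rewrite ler_wpM2r ?exprn_ge0 ?(ltW p0)//.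
      by have := lerB_dist (c r) (f y); rewrite distrC; lra.
    by rewrite ler_wpM2l ?(ltW w0)// -exprMn lerXn2r// ?nnegrE; lra.
  by rewrite /value_const -/t le_eqVlt; apply/orP; left; apply/eqP; rewrite /t; ring.
have S0 := star_side_gt0 l0 r.
have sS := star_side_ge l0 rt.
(* An auxiliary cube at [x], needed only to see that [x] lies in [cube b (star_side l r)]. *)
have [b' [b'a b'b]] := clip_cube a (x - const_mx (p / 2)) l0 p0.
exists b, (star_side l r); split=> //.
- by lra.
- by rewrite ge_min lexx orbT.
- have xb : cube (x - const_mx (p / 2)) p x.
    by move=> i; rewrite !mxE; apply/andP; split; lra.
  rewrite min_l// in b'a b'b; have b'x : cube b' p x by exact: b'b.
  exact: (bmax b' p x p0 pr b'a rx b'x).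
rewrite ler_pdivlMr ?exprn_gt0//.
apply: (@le_trans _ _ ((`|c r| - 6 ^+ N * w) * star_side l r ^+ N)).
  rewrite ler_wpM2r ?exprn_ge0 ?(ltW S0)//.
  by have := lerB_dist (f y) (c r); rewrite /value_const mulrDl -/t; lra.
rewrite mulrBl lerBlDr; apply: (le_trans cb); rewrite lerD2l.
rewrite [_ * w]mulrC -mulrA ler_wpM2l ?(ltW w0)// -exprMn lerXn2r// ?nnegrE; lra.
Qed.

(** Small means near [x] are bounded through values of [f] at points off [O] close to [x].
    Continuity there compares these with one value, which a single cube at [x] of larger or equal
    side nearly attains. *)
Lemma small_cubes x (e : R) : (cube a l `\` U) x -> 0 < e ->
  exists2 delta : R, 0 < delta & exists b0 s, [/\ 0 < s, cube b0 s x &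
    forall x' b p, (cube a l `\` U) x' -> row_close delta x x' -> 0 < p ->
      p <= delta -> cube b p x' -> cube b p `<=` cube a l ->
      fmean b p <= fmean b0 s + e].
Proof.
move=> Qx e0; have C0 := value_const_gt0; have la0 : 0 < l `^ alpha by rewrite powR_gt0.
pose w := e / (l `^ alpha * (2 + 2 * value_const)).
have w0 : 0 < w by rewrite divr_gt0// mulr_gt0//; lra.
have QO z : (cube a l `\` U) z -> (cube a l `\` O) z.
  by move=> [az nUz]; split=> // /OU.
have [rf rf0 fP] := f_cont (QO x Qx) w0.
have [rho rho0 osc] := f_osc w0.
(* The point [y] is within [2 * p] of [x'], which is within [d] of [x]; hence [3 * d <= rf]. *)
pose d := Num.min l (Num.min (rho / 6) (rf / 3)).
have d0 : 0 < d by rewrite !lt_min l0 !divr_gt0.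
have dl : d <= l by rewrite ge_min lexx.
have drho : 6 * d <= rho.
  have : d <= rho / 6 by rewrite !ge_min lexx /= orbT.
  by lra.
have drf : 3 * d <= rf.
  have : d <= rf / 3 by rewrite !ge_min lexx /= !orbT.
  by lra.
have [y0 [Oy0 xy0 _ [b0 [s [ds sl b0x b0a Js]]]]] := near_value w0 rho0 osc Qx d0 dl drho.
exists d => //; exists b0, s; split=> //; first exact: lt_le_trans ds.
move=> x' b p Qx' xx' p0 pd bx' ba.
have pl : p <= l by exact: le_trans dl.
have prho : 6 * p <= rho by lra.
have [y [Oy xy Jp _]] := near_value w0 rho0 osc Qx' p0 pl prho.
have f0 : `|f x - f y0| < w by apply: fP => // i; have := xy0 i; lra.
have f1 : `|f x - f y| < w.
  apply: fP => // i; have := xx' i; have := xy i.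
  by have := ler_distD (x' 0 i) (x 0 i) (y 0 i); lra.
have {}Jp := Jp b bx' ba.
have h : J b p / p ^+ N <= J b0 s / s ^+ N + (2 + 2 * value_const) * w.
  have := ler_distD (f x) (f y) (f y0); rewrite [in X in _ <= X + _]distrC.
  by have := lerB_dist (f y) (f y0); lra.
have := @fmean_medium _ _ alpha alpha_ge0 l J J_ge0 b p b0 s _ p0 (le_trans pd ds) sl h.
have -> : l `^ alpha * ((2 + 2 * value_const) * w) = e.
  by rewrite /w; field; rewrite gt_eqF//=; lra.
by apply; rewrite mulr_ge0 ?(ltW w0)//; lra.
Qed.

Lemma fmax_fin x : (cube a l `\` U) x -> fmax x \is a fin_num.
Proof.
move=> Qx; have [d d0 [b0 [s [s0 b0x h]]]] := small_cubes Qx ltr01.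
rewrite ge0_fin_numE; last by apply: le_trans (fmean_fmax alpha J s0 b0x);
  rewrite lee_fin fmean_ge0.
pose z := Num.max (fmean b0 s + 1) (d `^ (- (N%:R - alpha)) * J a l).
apply: (@le_lt_trans _ _ z%:E); last exact: ltry.
apply: (fmax_le beta_le alpha_lt l0 J_ge0 J_le Qx.1) => b p p0 bx ba.
rewrite le_max; have [pd|dp] := leP p d.
  by rewrite (h x)// => i; rewrite subrr normr0.
apply/orP; right; apply: ler_pM; rewrite ?powR_ge0//.
  by apply: (fweight_le beta_le alpha_lt) => //; exact: ltW.
by apply: J_le => y [].
Qed.

(** The lower bound holds because a supremum over open cubes is lower semicontinuous. For the upper
    bound, small cubes fall under [small_cubes], and large ones are enlarged slightly to contain
    [x]. *)
Lemma fmax_close x (e : R) : (cube a l `\` U) x -> 0 < e ->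
  exists2 r : R, 0 < r & forall x', (cube a l `\` U) x' -> row_close r x x' ->
    (fmax x - e%:E <= fmax x' <= fmax x + e%:E)%E.
Proof.
move=> Qx e0; have /fineK ME := fmax_fin Qx; set M := fine _ in ME.
have [d d0 [b0 [s [s0 b0x h]]]] := small_cubes Qx e0.
pose B := d `^ (- (N%:R - alpha)) * J a l.
have B0 : 0 <= B by rewrite mulr_ge0 ?powR_ge0.
(* Makes the error [N%:R * (2 * r1) / d * B] of [fmean_large] at most [e]. *)
pose r1 := Num.min d (e * d / (2 * N%:R * (B + 1))).
have N0 : 0 < N%:R :> R by rewrite ltr0n.
have r10 : 0 < r1 by rewrite lt_min d0 !divr_gt0 ?mulr_gt0//; lra.
have [r2 r20 low] : exists2 r : R, 0 < r & forall y, row_close r x y ->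
    (fmax x - e%:E <= fmax y)%E.
  have : ((M - e)%:E < fmax x)%E by rewrite -ME lte_fin; lra.
  move=> /ereal_sup_gt[_ [b [p [p0 bx ->]]] Mb].
  have [r r0 br] := cube_close bx; exists r => // y xy.
  rewrite -ME -EFinB; apply: (le_trans (ltW Mb)).
  by apply: fmean_fmax => //; exact: br.
exists (Num.min r1 r2); first by rewrite lt_min r10.
move=> x' Qx' xx'; apply/andP; split.
  by apply: low => i; apply: (lt_le_trans (xx' i)); rewrite ge_min lexx orbT.
have {}xx' : row_close r1 x x'.
  by move=> i; apply: (lt_le_trans (xx' i)); rewrite ge_min lexx.
rewrite -ME -EFinD.
apply: (fmax_le beta_le alpha_lt l0 J_ge0 J_le Qx'.1) => b p p0 bx' ba.
have fM b1 p1 : 0 < p1 -> cube b1 p1 x -> fmean b1 p1 <= M.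
  by move=> p10 b1x; rewrite -lee_fin ME; exact: fmean_fmax.
have [pd|dp] := leP p d.
  apply: (le_trans (h x' b p _ _ _ _ _ _)) => //.
    by move=> i; apply: (lt_le_trans (xx' i)); rewrite ge_min lexx.
  by rewrite lerD2r; exact: fM.
pose b1 := b - const_mx r1.
have b1P z i : b1 0 i < z 0 i < b1 0 i + (p + 2 * r1) <->
    b 0 i - r1 < z 0 i < b 0 i + p + r1.
  by rewrite !mxE; split=> /andP[u v]; apply/andP; split; lra.
have b1x : cube b1 (p + 2 * r1) x.
  move=> i; apply/b1P; have := bx' i; have := xx' i.
  by rewrite ltr_norml => /andP[u v] /andP[u' v']; apply/andP; split; lra.
have Jb : J b p <= J b1 (p + 2 * r1).
  apply: J_le => z [bz _] i; apply/b1P; have /andP[u v] := bz i.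
  by apply/andP; split; lra.
have pp : p <= p + 2 * r1 by lra.
have := fmean_large beta_le alpha_ge0 alpha_lt J_ge0 J_le d0 (ltW dp) pp (lexx _) Jb.
move=> /le_trans; apply; apply: lerD; first by apply: fM => //; lra.
rewrite -/B.
apply: (@le_trans _ _ (N%:R * (2 * (e * d / (2 * N%:R * (B + 1)))) / d * B)).
  rewrite ler_wpM2r// ler_wpM2r ?invr_ge0 ?(ltW d0)// ler_wpM2l ?(ltW N0)//.
  by rewrite ler_wpM2l// ge_min lexx orbT.
have -> : N%:R * (2 * (e * d / (2 * N%:R * (B + 1)))) / d * B = e * (B / (B + 1)).
  by field; rewrite !gt_eqF//; lra.
by rewrite ger_pMr// ler_pdivrMr; lra.
Qed.

End fmax_continuity.

(** * The Choquet integral *)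
Section integral_test.
Context {R : realType}.
Local Open Scope ereal_scope.
Variables (phi : R -> \bar R).
Hypothesis phi_ge0 : forall t, 0 <= phi t.
Hypothesis phi_anti : forall s t, (s <= t)%R -> phi t <= phi s.

(** The preimage of an upper ray under a monotone function is an interval. *)
Lemma nonincreasing_emeasurable (A : set R) : measurable A -> measurable_fun A phi.
Proof.
move=> mA; apply: (measurability _ (ErealGenOInfty.measurableE R)) => // _ [_ [r ->] <-].
apply: measurableI => //; apply: is_interval_measurable => s t /=.
rewrite !in_itv/= !andbT => rs rt u /andP[su ut].
by rewrite in_itv/= andbT; apply: lt_le_trans rt _; exact: phi_anti.
Qed.

Variable tau : R.
Hypothesis tau0 : (0 < tau)%R.

Let I (k : nat) : set R := `[(k%:R * tau)%R, (k.+1%:R * tau)%R[%classic.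

Let mI k : measurable (I k). Proof. exact: measurable_itv. Qed.

Let step (c : nat -> \bar R) (t : R) : \bar R := \sum_(k <oo) (c k * (\1_(I k) t)%:E).

Let stepE (c : nat -> \bar R) (t : R) : (forall k, 0 <= c k) -> (0 <= t)%R ->
  exists k, I k t /\ step c t = c k.
Proof.
move=> c0 t0; exists (Num.truncn (t / tau)).
have tt0 : (0 <= t / tau)%R by rewrite divr_ge0// ltW.
have /andP[h1 h2] := truncn_itv tt0.
have It : I (Num.truncn (t / tau)) t.
  by rewrite /I/= in_itv/= -ler_pdivlMr// h1 -ltr_pdivrMr.
split=> //; rewrite /step (@nneseriesD1 _ _ (Num.truncn (t / tau)) xpredT)//; last first.
  by move=> k _; rewrite mule_ge0// lee_fin.
rewrite indicE mem_set// mule1 eseries0 ?adde0// => k _ /= kt.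
rewrite indicE memNset ?mule0// /I/= in_itv/= => /andP[h3 h4]; case/eqP: kt.
by rewrite (@truncn_def _ (t / tau)%R k)// ler_pdivlMr// h3 ltr_pdivrMr.
Qed.

Let step_measurable (c : nat -> \bar R) : (forall k, 0 <= c k) ->
  measurable_fun (`[0%R, +oo[%classic : set R) (step c).
Proof.
move=> c0; apply: ge0_emeasurable_sum => [k t _ _|k _].
  by rewrite mule_ge0// lee_fin.
by apply: measurable_funeM; apply/measurable_EFinP; apply: measurable_indic; exact: mI.
Qed.

Let integral_step (c : nat -> \bar R) : (forall k, 0 <= c k) ->
  \int[lebesgue_measure]_(t in `[0%R, +oo[) step c t = \sum_(k <oo) (c k * tau%:E).
Proof.
move=> c0; rewrite integral_nneseries//; last 2 first.
- by move=> k; apply: measurable_funeM; apply/measurable_EFinP; apply: measurable_indic;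
  exact: mI.
- by move=> k t _; rewrite mule_ge0// lee_fin.
apply: eq_eseriesr => k _; rewrite ge0_integralZl//=; last first.
  by apply/measurable_EFinP; apply: measurable_indic; exact: mI.
congr (_ * _); rewrite integral_indic//; last exact: mI.
rewrite setIidl; last first.
  move=> t; rewrite /I/= !in_itv/= andbT => /andP[h _]; apply: (le_trans _ h).
  by rewrite mulr_ge0// ltW.
rewrite /= lebesgue_measure_co -mulrBl -natrB// subSnn mul1r max_r//; exact: ltW.
Qed.

Lemma integral_le_sum : \int[lebesgue_measure]_(t in `[0%R, +oo[) phi t <=
  \sum_(k <oo) (phi (k%:R * tau) * tau%:E).
Proof.
rewrite -integral_step//; apply: ge0_le_integral => //.
- exact: nonincreasing_emeasurable.
- exact: step_measurable.
move=> t /=; rewrite in_itv/= andbT => t0.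
have [k [/=]] := @stepE (fun k => phi (k%:R * tau)) t (fun=> phi_ge0 _) t0.
by rewrite /I/= in_itv/= => /andP[h _] ->; exact: phi_anti.
Qed.

Lemma integral_ge_sum : \sum_(k <oo) (phi (k.+1%:R * tau) * tau%:E) <=
  \int[lebesgue_measure]_(t in `[0%R, +oo[) phi t.
Proof.
rewrite -integral_step//; apply: ge0_le_integral => //.
- by move=> t _; apply: nneseries_ge0 => k _ _; rewrite mule_ge0// lee_fin.
- exact: step_measurable.
- exact: nonincreasing_emeasurable.
move=> t /=; rewrite in_itv/= andbT => t0.
have [k [/=]] := @stepE (fun k => phi (k.+1%:R * tau)) t (fun=> phi_ge0 _) t0.
by rewrite /I/= in_itv/= => /andP[_ /ltW h] ->; exact: phi_anti.
Qed.

End integral_test.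

Section choquet_theory.
Context {R : realType} {n : nat}.
Local Open Scope ereal_scope.
Local Notation V := 'rV[R]_n.+1.
Variables (beta : R) (E : set V) (g : V -> \bar R).
Local Notation lev t := [set x | E x /\ t%:E < g x].

Let lev_ge0 (t : R) : 0 <= hcontent beta (lev t).
Proof. by apply: cover_content_ge0 => q; exact: powR_ge0. Qed.

Let lev_anti (s t : R) : (s <= t)%R -> hcontent beta (lev t) <= hcontent beta (lev s).
Proof.
move=> st; apply: le_cover_content => x [Ex tx]; split=> //.
by apply: le_lt_trans tx; rewrite lee_fin.
Qed.

Lemma choquet_ge0 : 0 <= choquet beta E g.
Proof. exact: integral_ge0. Qed.

Lemma choquet_le_sum (tau : R) : (0 < tau)%R -> choquet beta E g <=
  \sum_(k <oo) (hcontent beta (lev (k%:R * tau)%R) * tau%:E).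
Proof. exact: integral_le_sum. Qed.

Lemma choquet_ge_sum (tau : R) : (0 < tau)%R ->
  \sum_(k <oo) (hcontent beta (lev (k.+1%:R * tau)%R) * tau%:E) <= choquet beta E g.
Proof. exact: integral_ge_sum. Qed.

(** The first term of the lower Riemann sum with mesh [t]. *)
Lemma markov_choquet (t : R) : (0 < t)%R ->
  hcontent beta (lev t) * t%:E <= choquet beta E g.
Proof.
move=> t0; apply: le_trans (choquet_ge_sum t0).
rewrite (@nneseriesD1 _ _ 0%N xpredT)//=; last by move=> *;
  rewrite mule_ge0// lee_fin ltW.
rewrite mul1r leeDl//; apply: nneseries_ge0 => *.
by rewrite mule_ge0// lee_fin ltW.
Qed.

Lemma choquet_geometric (tau A B : R) : (0 < tau)%R -> (0 <= B)%R ->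
  hcontent beta E <= A%:E ->
  (forall j : nat, hcontent beta (lev (j.+1%:R * tau)%R) <= (B * (2^-1) ^+ j)%:E) ->
  choquet beta E g <= ((A + 2 * B) * tau)%:E.
Proof.
move=> tau0 B0 EA decay; apply: le_trans (choquet_le_sum tau0) _.
rewrite nneseries_recl//=; last by move=> *; rewrite mule_ge0// lee_fin ltW.
rewrite mulrDl EFinD; apply: leeD.
  rewrite [leRHS]EFinM; apply: lee_wpmul2r; first by rewrite lee_fin ltW.
  by apply: le_trans EA; apply: le_cover_content => x [].
rewrite -(@nneseries_addn _ _ 1); last by move=> *; rewrite mule_ge0// lee_fin ltW.
(* The geometric series is summed by [epsilon_trick0], which splits [2 * B * tau] into the parts
   [B * tau / 2 ^ k]. *)
have eps0 : (0 <= 2 * B * tau)%R by rewrite !mulr_ge0// ltW.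
apply: le_trans (epsilon_trick0 xpredT eps0).
apply: lee_nneseries => k _; first by move=> _; rewrite mule_ge0// lee_fin ltW.
rewrite addn1; apply: (@le_trans _ _ ((B * (2^-1) ^+ k)%:E * tau%:E)).
  by apply: lee_wpmul2r; [rewrite lee_fin ltW|exact: decay].
rewrite -EFinM lee_fin natrX exprS exprVn.
have z0 : (0 < (2 : R) ^+ k)%R by rewrite exprn_gt0.
move: (2 ^+ k)%R z0 => z z0.
by rewrite le_eqVlt; apply/orP; left; apply/eqP; field; rewrite gt_eqF.
Qed.

End choquet_theory.

(** * Lebesgue measure on row vectors *)
Section lebesgue_measurability.
Context {R : realType} {n : nat}.
Local Notation V := 'rV[R]_n.+1.
Local Notation leb := (@lebesgue_outer_measure R n).
Local Notation mT := (caratheodory_type leb).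

Lemma measurable_halfspace (i : 'I_n.+1) (t : R) :
  measurable ([set x : V | x 0 i < t] : set mT).
Proof.
apply: le_caratheodory_measurable => X.
rewrite [X in (_ <= X)%E]/=; apply: cover_content_glb => ab Xab.
(* The hyperplane cuts each covering box into two boxes whose volumes add up; a half with reversed
   endpoints is empty and has volume 0. *)
pose lo k : V * V := ((ab k).1, \row_j if j == i then Num.min ((ab k).2 0 j) t else (ab
  k).2 0 j).
pose hi k : V * V := (\row_j (if j == i then Num.max ((ab k).1 0 j) t else (ab k).1 0
  j), (ab k).2).
have -> : (\sum_(k <oo) (box_volume (ab k))%:E =
    \sum_(k <oo) (box_volume (lo k))%:E + \sum_(k <oo) (box_volume (hi k))%:E)%E.
  rewrite -nneseriesD; [|by move=> *; rewrite lee_fin box_volume_ge0..].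
  apply: eq_eseriesr => k _; rewrite -EFinD; congr (_%:E).
  have D1 (uv : V * V) : box_volume uv = Num.max 0 (uv.2 0 i - uv.1 0 i) *
      \prod_(j | j != i) Num.max 0 (uv.2 0 j - uv.1 0 j).
    by rewrite /box_volume (bigD1 i).
  rewrite !D1 /=.
  have -> : \prod_(j | j != i) Num.max 0 ((lo k).2 0 j - (lo k).1 0 j) =
      \prod_(j | j != i) Num.max 0 ((ab k).2 0 j - (ab k).1 0 j).
    by apply: eq_bigr => j ji; rewrite !mxE (negPf ji).
  have -> : \prod_(j | j != i) Num.max 0 ((hi k).2 0 j - (hi k).1 0 j) =
      \prod_(j | j != i) Num.max 0 ((ab k).2 0 j - (ab k).1 0 j).
    by apply: eq_bigr => j ji; rewrite !mxE (negPf ji).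
  rewrite -mulrDl !mxE eqxx; congr (_ * _).
  move: ((ab k).1 0 i) ((ab k).2 0 i) => u v.
  by case: (leP v t) => ?; case: (leP u t) => ?; do ![case: (leP 0) => ?]; lra.
apply: leeD; apply: cover_content_le => x [Xx].
  move=> /= xt; have [k _ xk] := Xab x Xx; exists k => // j; rewrite !mxE.
  have /andP[-> /=] := xk j; case: eqP => [ji|//]; rewrite lt_min => ->.
  by rewrite ji.
move=> /= xt; have [k _ xk] := Xab x Xx; exists k => // j; rewrite !mxE.
have /andP[+ ->] := xk j; rewrite andbT; case: eqP => [ji|//] h.
by rewrite ge_max h ji leNgt; apply/negP.
Qed.

Lemma measurable_hcube b (s : R) : measurable (hcube b s : set mT).
Proof.
have -> : hcube b s = \bigcap_(i in [set: 'I_n.+1])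
    (~` [set x : V | x 0 i < b 0 i] `&` [set x : V | x 0 i < b 0 i + s]).
  apply/seteqP; split=> x h i.
    by move=> _; have /andP[h1 h2] := h i; split=> //=; apply/negP; rewrite -leNgt.
  by have [/negP] := h i I; rewrite -leNgt => -> /= ->.
apply: fin_bigcap_measurable => // i _.
by apply: measurableI; [apply: measurableC|]; exact: measurable_halfspace.
Qed.

Lemma open_measurable_row (U : set V) : open U -> measurable (U : set mT).
Proof.
move=> oU; pose F q : set mT := if `[< gcube (0 : V) 1 q `<=` U >]
  then gcube (0 : V) 1 q else set0.
have -> : U = \bigcup_q F q.
  apply/seteqP; split=> x; last first.
    by move=> [q _]; rewrite /F; case: asboolP => // + qx; exact.
  move=> Ux; have /nbhs_rowP[r r0 rU] : nbhs x U by exact: open_nbhs_nbhs.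
  have [q [qx /andP[_ qr]]]
    := exists_gcube (0 : V) (@ltr01 R) x (divr_gt0 r0 (@ltr0Sn R 1)).
  exists q => //; rewrite /F; case: asboolP => // h; exfalso; apply: h => y qy.
  apply: rU => i; have /andP[h1 h2] := qx i; have /andP[h3 h4] := qy i.
  by rewrite ltr_norml; apply/andP; split; lra.
apply: countable_bigcupT_measurable => [|q]; first exact: countableP.
by rewrite /F; case: ifP => // _; exact: measurable_hcube.
Qed.

End lebesgue_measurability.

Section quasicontinuous_measurability.
Context {R : realType} {n : nat}.
Local Notation V := 'rV[R]_n.+1.
Local Notation leb := (@lebesgue_outer_measure R n).
Local Notation mT := (caratheodory_type leb).
Variables (beta : R).
Hypothesis beta_gt0 : 0 < beta.
Hypothesis beta_le : beta <= n.+1%:R.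
Variables (a : V) (l : R).
Hypothesis l0 : 0 < l.
Variable f : V -> R.

Lemma within_continuous_close (A : set V) :
  {within A, continuous (fun x => (f x)%:E)} -> forall x, A x ->
  forall e : R, 0 < e ->
  exists2 r : R, 0 < r & forall y, A y -> row_close r x y -> `|f x - f y| < e.
Proof.
move=> fc x Ax e e0; have := fc x.
rewrite /continuous_at /= => /fine_cvgP[_] /cvgrPdist_lt/(_ e e0) near_x.
have : within A (nbhs x) [set y | `|f x - f y| < e] by rewrite nbhs_subspace_in.
move=> /nbhs_rowP[r r0 rP]; exists r => // y Ay xy.
by apply: rP.
Qed.

Hypothesis f_supp : forall x, f x != 0 -> cube a l x.
Hypothesis f_quasi : quasicontinuous beta (cube a l) (fun x => (f x)%:E).

(** The intersection [Z] of the exceptional sets is Lebesgue null, as volume is controlled by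
    content inside [cube a l]. Off each of them [f] is continuous and outside the cube it is 0, so
    completeness of the measure concludes. *)
Lemma quasicontinuous_measurable : measurable_fun setT (f : mT -> R).
Proof.
move=> mTT; apply: (measurability _ (RGenOInfty.measurableE R)) => // _ [_ [r ->] <-].
rewrite setTI; set S := (X in measurable X).
have SE x : S x <-> r < f x by rewrite /S/= in_itv/= andbT.
have /choice[B BP] k : exists O : set V, [/\ open O, O `<=` cube a l,
    (hcontent beta O < (k.+1%:R^-1)%:E)%E &
    {within cube a l `\` O, continuous (fun x => (f x)%:E)}].
  have k0 : 0 < k.+1%:R^-1 :> R by rewrite invr_gt0.
  by have [W [oW Wa HW _ cW]] := f_quasi k0; exists W; split.
pose Z : set mT := \bigcap_k B k.
have mB k : measurable (B k : set mT) by have [oO _ _ _] := BP k;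
  exact: open_measurable_row.
have mZ : measurable Z by apply: bigcapT_measurable => k; exact: mB.
have mQ : measurable (cube a l : set mT) by apply/open_measurable_row/open_cube.
have Z0 : lebesgue_outer Z = 0%E.
  apply/eqP; rewrite eq_le outer_measure_ge0 andbT.
  apply/lee_addgt0Pr => e e0; rewrite add0e.
  pose C := l `^ (n.+1%:R - beta); have C0 : 0 < C by rewrite powR_gt0.
  pose k := Num.truncn (C / e).
  have [_ Oa HO _] := BP k.
  have ZO : (lebesgue_outer Z <= lebesgue_outer (B k))%E.
    by apply: le_outer_measure => x; exact.
  apply: (le_trans ZO).
  apply: (@le_trans _ _ (C%:E * (k.+1%:R^-1)%:E)%E).
    apply: (@le_trans _ _ (C%:E * hcontent beta (B k))%E).
      rewrite hcontentE; apply: lebesgue_outer_le_gcontent => //.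
      by rewrite -(lebesgue_outer_cube a l0); exact: le_outer_measure.
    by apply: lee_wpmul2l; [rewrite lee_fin ltW|exact: ltW].
  rewrite -EFinM lee_fin ler_pdivrMr// mulrC -ler_pdivrMr//.
  by apply: ltW; apply: truncnS_gt.
have -> : S = (S `&` ~` cube a l) `|` ((S `&` Z) `|` \bigcup_k (S `&` (cube a l `\` B
  k))).
  apply/seteqP; split=> x; last by move=> [[]//|[[]//|[k _ []]//]].
  move=> Sx; have [Qx|nQx] := pselect (cube a l x); last by left.
  right; have [Zx|/existsNP[k nk]] := pselect (forall k, B k x); first by left;
    split=> // k _.
  by right; exists k => //; split=> //; split=> // Okx; apply: nk.
apply: measurableU; last apply: measurableU.
- have [r0|r0] := ltP r 0.
    rewrite setIidr; first exact: measurableC.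
    by move=> x nQx; apply/SE; rewrite (_ : f x = 0)//; apply/eqP;
      apply: contrapT => /negP/f_supp.
  rewrite (_ : _ `&` _ = set0); first exact: measurable0.
  apply/seteqP; split=> x // [/SE rx nQx]; apply: nQx; apply: f_supp.
  by rewrite gt_eqF//; exact: le_lt_trans rx.
- apply: (@measure_is_complete_caratheodory R V leb); exists Z.
  by split=> //; exact: subIsetr.
apply: bigcupT_measurable => k; have [oO Oa _ cO] := BP k.
(* Writes a relatively open subset of [cube a l]\[B k] as the trace of an open set. *)
have -> : S `&` (cube a l `\` B k) = (S `|` ~` (cube a l `\` B k))^° `&` (cube a l `\` B
  k).
  apply/seteqP; split=> x [h Ax]; split=> //; last first.
    by have [] := interior_subset h.
  apply/nbhs_rowP; have e0 : 0 < f x - r by rewrite subr_gt0; apply/SE.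
  have [d d0 dP] := within_continuous_close cO Ax e0; exists d => // y xy.
  have [Ay|] := pselect ((cube a l `\` B k) y); last by right.
  by left; apply/SE; have := dP y Ay xy; rewrite ltr_norml => /andP[_]; lra.
apply: measurableI; first by apply: open_measurable_row; exact: open_interior.
exact: measurableD.
Qed.

End quasicontinuous_measurability.

(** * Means of quasicontinuous functions *)
Section means.
Context {R : realType} {n : nat}.
Local Notation V := 'rV[R]_n.+1.
Local Notation N := n.+1.
Local Notation leb := (@lebesgue_outer_measure R n).
Local Notation mT := (caratheodory_type leb).
Local Notation mu := (@lebesgueRn R n).
Variables (beta : R).
Hypothesis beta_gt0 : 0 < beta.
Hypothesis beta_le : beta <= N%:R.
Implicit Types (b : V) (p : R).

Lemma measurable_cube b p : measurable (cube b p : set mT).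
Proof. exact/open_measurable_row/open_cube. Qed.

Lemma lebesgueRn_cube b p : 0 < p -> mu (cube b p) = (p ^+ N)%:E.
Proof. exact: lebesgue_outer_cube. Qed.

(** A discrete layer-cake bound; the minimum lets it be proved by induction on the number of
    layers. *)
Lemma partial_layers (tau z : R) (m : nat) : 0 <= z -> 0 <= tau ->
  Num.min z (m%:R * tau) <= \sum_(0 <= k < m) (if k%:R * tau < z then tau else 0).
Proof.
move=> z0 tau0; elim: m => [|m ih]; first by rewrite mul0r big_nil ge_min lexx orbT.
rewrite big_nat_recr//= -natr1 mulrDl mul1r.
move: (\sum_(_ <= _ < _) _) ih => S; move: (m%:R * tau) => y.
by case: (ltP y z) => h1; case: (leP z y) => h2; case: (leP z (y + tau)); lra.
Qed.

(* Only the levels [k.+1 * tau] are charged to the Choquet integral; the bottom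
   layer contributes [tau * p ^+ N]. *)
Lemma integral_le_choquet (h : V -> R) b p (tau : R) : 0 < p -> 0 < tau ->
  measurable_fun setT (h : mT -> R) ->
  (\int[mu]_(x in (cube b p : set mT)) `|h x|%:E <=
   (tau * p ^+ N)%:E +
   (p `^ (N%:R - beta))%:E * choquet beta (cube b p) (fun x => `|h x|%:E))%E.
Proof.
move=> p0 tau0 mh; have mQ := measurable_cube b p.
pose A (k : nat) : set mT := [set x | cube b p x /\ k%:R * tau < `|h x|].
have mA k : measurable (A k).
  have -> : A k = cube b p `&` (fun x => `|h x|) @^-1` `]k%:R * tau, +oo[.
    by apply/seteqP; split=> x [Qx]; rewrite /= in_itv/= andbT.
  apply: measurableI => //; rewrite -[X in measurable X]setTI.
  exact: (measurableT_comp (@normr_measurable R setT) mh).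
have Ap k : (leb (A k) <= (p ^+ N)%:E)%E.
  by rewrite -(lebesgue_outer_cube b p0); apply: le_outer_measure => x [].
have layer x : cube b p x -> (`|h x|%:E <= \sum_(k <oo) (tau%:E * (\1_(A k) x)%:E))%E.
  move=> Qx; pose m := (Num.truncn (`|h x| / tau)).+1.
  apply: (le_trans _ (@nneseries_lim_ge _ _ xpredT 0 m _)); last first.
    by move=> k _ _; rewrite -EFinM lee_fin mulr_ge0// ltW.
  rewrite (eq_bigr (fun k : nat => (if k%:R * tau < `|h x| then tau else 0)%:E)).
    rewrite sumEFin lee_fin; apply: le_trans (partial_layers m (normr_ge0 _) (ltW tau0)).
    by rewrite le_min lexx -ler_pdivrMr// ltW// truncnS_gt.
  move=> k _; rewrite -EFinM indicE; congr (_%:E); case: ifPn => kh.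
    by rewrite mem_set ?mulr1.
  by rewrite memNset ?mulr0// => -[_]; apply/negP.
have mI k D : measurable_fun D (fun x : mT => tau%:E * (\1_(A k) x)%:E)%E.
  by apply: measurable_funeM; apply/measurable_EFinP; exact: measurable_indic.
apply: (@le_trans _ _ (\int[mu]_(x in (cube b p : set mT))
    \sum_(k <oo) (tau%:E * (\1_(A k) x)%:E))%E).
  apply: ge0_le_integral; first exact: mQ.
  - by move=> x _; rewrite lee_fin.
  - apply/measurable_EFinP; apply: measurable_funTS.
    exact: (measurableT_comp (@normr_measurable R setT) mh).
  - apply: ge0_emeasurable_sum => [k x _ _|k _]; last exact: mI.
    by rewrite -EFinM lee_fin mulr_ge0// ltW.
  exact: layer.
rewrite integral_nneseries//; last first.
  by move=> k x _; rewrite -EFinM lee_fin mulr_ge0// ltW.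
rewrite (eq_eseriesr (g := fun k => (tau%:E * leb (A k))%E)); last first.
  move=> k _; rewrite ge0_integralZl//; [|by apply/measurable_EFinP;
    exact: measurable_indic|by rewrite lee_fin ltW].
  by rewrite integral_indic// setIidl// => x [].
rewrite nneseries_recl//=; last by move=> k _;
  rewrite mule_ge0 ?lee_fin ?(ltW tau0)// outer_measure_ge0.
apply: leeD.
  by rewrite EFinM; apply: lee_wpmul2l; [rewrite lee_fin ltW|exact: Ap].
rewrite -(@nneseries_addn _ _ 1); last by move=> k;
  rewrite mule_ge0 ?lee_fin ?(ltW tau0)// outer_measure_ge0.
pose C := p `^ (N%:R - beta); have C0 : 0 < C by rewrite powR_gt0.
apply: (@le_trans _ _ (C%:E * \sum_(k <oo)
    (hcontent beta [set x | cube b p x /\ ((k.+1%:R * tau)%:E < `|h x|%:E)%E]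
      * tau%:E))%E).
  rewrite -nneseriesZl; last first.
    move=> k _; rewrite mule_ge0 ?lee_fin ?(ltW tau0)//.
    by apply: cover_content_ge0 => q; exact: powR_ge0.
  apply: lee_nneseries => k _.
    by move=> _; rewrite mule_ge0 ?lee_fin ?(ltW tau0)// outer_measure_ge0.
  rewrite addn1 muleA muleC; apply: lee_wpmul2r; first by rewrite lee_fin ltW.
  by rewrite hcontentE; apply: lebesgue_outer_le_gcontent => //; exact: Ap.
apply: lee_wpmul2l; first by rewrite lee_fin ltW.
exact: choquet_ge_sum.
Qed.

Lemma hcontent_cube b p : 0 < p -> exists2 h : R, hcontent beta (cube b p) = h%:E &
  p `^ beta <= h <= @grid_const R n beta * p `^ beta.
Proof.
move=> p0; rewrite hcontentE.
have lo := gcontent_ge_cube beta_gt0 beta_le 0 ltr01 p0 (@subset_refl _ (cube b p)).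
have up := gcontent_cube beta_gt0 (0 : V) ltr01 b p0.
have Hfin : gcontent beta (0 : V) 1 (cube b p) \is a fin_num.
  by rewrite ge0_fin_numE ?gcontent_ge0//; apply: (le_lt_trans up); exact: ltry.
exists (fine (gcontent beta (0 : V) 1 (cube b p))); first by rewrite fineK.
by rewrite -!lee_fin fineK// lo up.
Qed.

Lemma mean_osc_lt (g : V -> \bar R) b p (w : R) : 0 < p ->
  (mean_osc beta g (cube b p) < w%:E)%E ->
  exists c : R, (choquet beta (cube b p) (fun x => `|g x - c%:E|) <=
    (w * (@grid_const R n beta * p `^ beta))%:E)%E.
Proof.
move=> p0 /ereal_inf_lt[_ [c _ <-]] cw; exists c.
have [h hE /andP[ph hp]] := hcontent_cube b p0.
have h0 : 0 < h by apply: lt_le_trans ph; rewrite powR_gt0.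
move: cw; rewrite hE inver gt_eqF// => /ltW; rewrite lee_pdivrMl// => cw.
have w0 : 0 <= w.
  rewrite -lee_fin -(@lee_pmul2l _ h%:E) ?lte_fin// mule0.
  by apply: le_trans cw; exact: choquet_ge0.
by apply: (le_trans cw); rewrite -EFinM lee_fin mulrC ler_wpM2l.
Qed.

Lemma mean_osc_le (g : V -> \bar R) b p (c M : R) : 0 < p -> 0 <= M ->
  (choquet beta (cube b p) (fun x => `|g x - c%:E|) <= (M * p `^ beta)%:E)%E ->
  (mean_osc beta g (cube b p) <= M%:E)%E.
Proof.
move=> p0 M0 cM; have [h hE /andP[ph hp]] := hcontent_cube b p0.
have h0 : 0 < h by apply: lt_le_trans ph; rewrite powR_gt0.
apply: (@le_trans _ _ ((hcontent beta (cube b p))^-1 *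
    choquet beta (cube b p) (fun x => `|g x - c%:E|))%E).
  by apply: ereal_inf_lbound; exists c.
rewrite hE inver gt_eqF// lee_pdivrMl//; apply: (le_trans cM).
by rewrite -EFinM lee_fin mulrC ler_wpM2r.
Qed.

Variables (a : V) (l : R).
Hypothesis l0 : 0 < l.
Variable f : V -> R.
Hypothesis f_supp : forall x, f x != 0 -> cube a l x.
Hypothesis mf : measurable_fun setT (f : mT -> R).

Definition abs_integral b p : \bar R :=
  (\int[mu]_(y in (cube b p : set mT)) `|f y|%:E)%E.

Let mabs c (D : set mT) : measurable_fun D (fun x : mT => `|f x - c|%:E).
Proof.
apply/measurable_EFinP; apply: measurable_funTS.
apply: (measurableT_comp (@normr_measurable R setT)).
by apply: measurable_funB => //; exact: measurable_cst.
Qed.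

Let mabs0 (D : set mT) : measurable_fun D (fun x : mT => `|f x|%:E).
Proof.
apply/measurable_EFinP; apply: measurable_funTS.
exact: (measurableT_comp (@normr_measurable R setT) mf).
Qed.

Lemma abs_integral_ge0 b p : (0 <= abs_integral b p)%E.
Proof. by apply: integral_ge0. Qed.

Lemma abs_integral_le b p b' p' : cube b p `&` cube a l `<=` cube b' p' ->
  (abs_integral b p <= abs_integral b' p')%E.
Proof.
move=> sub; rewrite /abs_integral.
have -> : (\int[mu]_(y in (cube b p : set mT)) `|f y|%:E =
    \int[mu]_(y in (cube b p `&` cube a l : set mT)) `|f y|%:E)%E.
  rewrite integral_mkcondr; apply: eq_integral => x _.
  rewrite patchE; case: ifPn => // /negP xa; rewrite (_ : f x = 0) ?normr0//.
  by apply/eqP; apply: contrapT => /negP/f_supp ax; apply: xa; rewrite inE.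
by apply: ge0_subset_integral => //; [apply: measurableI|]; exact: measurable_cube.
Qed.

Lemma abs_integral_compare b p b' p' (c X : R) : 0 < p' -> cube b' p' `<=` cube b p ->
  (\int[mu]_(y in (cube b p : set mT)) `|f y - c|%:E <= X%:E)%E ->
  (abs_integral b' p' <= (`|c| * p' ^+ N + X)%:E)%E /\
  ((`|c| * p' ^+ N)%:E <= abs_integral b' p' + X%:E)%E.
Proof.
move=> p0 sub bX; have mQ' := measurable_cube b' p'; have mQ := measurable_cube b p.
have {}bX : (\int[mu]_(y in (cube b' p' : set mT)) `|f y - c|%:E <= X%:E)%E.
  by apply: le_trans bX; apply: ge0_subset_integral.
have cE : (\int[mu]_(y in (cube b' p' : set mT)) `|c|%:E = (`|c| * p' ^+ N)%:E)%E.
  by rewrite integral_cst// EFinM; congr (_ * _)%E; exact: lebesgueRn_cube.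
split.
  apply: (@le_trans _ _ (\int[mu]_(y in (cube b' p' : set mT)) (`|c|%:E + `|f y -
    c|%:E))%E).
    apply: ge0_le_integral; first exact: mQ'.
    - by move=> x _; rewrite lee_fin.
    - exact: mabs0.
    - by apply: emeasurable_funD; [exact: measurable_cst|exact: mabs].
    by move=> x _; rewrite -EFinD lee_fin; have := ler_normD c (f x - c); rewrite subrKC.
  rewrite ge0_integralD//.
  by rewrite cE EFinD; apply: leeD.
rewrite -cE; apply: (@le_trans _ _ (\int[mu]_(y in (cube b' p' : set mT)) (`|f y|%:E +
  `|f y - c|%:E))%E).
  apply: ge0_le_integral; first exact: mQ'.
  - by move=> x _; rewrite lee_fin.
  - exact: measurable_cst.
  - by apply: emeasurable_funD; [exact: mabs0|exact: mabs].
  by move=> x _; rewrite -EFinD lee_fin; have := ler_normB (f x) (f x - c);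
    rewrite opprB addrC subrK.
by rewrite ge0_integralD//; apply: leeD.
Qed.

(** The product of two grid constants serves the weak-type bound: one normalises by the content of
    the cube, the other changes the grid. The sum [1 + grid_const] serves the mean bound. *)
Definition osc_factor : R :=
  @grid_const R n beta * @grid_const R n beta + (1 + @grid_const R n beta).

Lemma small_osc b p (w : R) : 0 < w -> 0 < p ->
  (mean_osc beta (fun x => (f x)%:E) (cube b p) < w%:E)%E ->
  exists c : R,
    (forall t : R, 0 < t -> (gcontent beta a l [set x |
      cube b p x /\ (t < `|f x - c|)%R] <=
       (osc_factor * w * p `^ beta / t)%:E)%E) /\
    (\int[mu]_(y in (cube b p : set mT)) `|f y - c|%:E <=
      (osc_factor * w * p ^+ N)%:E)%E.
Proof.
move=> w0 p0 /(mean_osc_lt p0)[c cw]; exists c.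
set C := grid_const beta in cw *; have C0 : 0 < C by exact: grid_const_gt0.
have pb0 : 0 <= p `^ beta by exact: powR_ge0.
split=> [t t0|].
  apply: (le_trans (gcontent_comparable beta_gt0 a 0 _ l0 ltr01)).
  rewrite -hcontentE -/C.
  have := markov_choquet beta (cube b p) (fun x => `|(f x)%:E - c%:E|%E) t0.
  move=> /le_trans/(_ cw); rewrite -lee_pdivlMr// => h.
  apply: (@le_trans _ _ (C%:E * ((w * (C * p `^ beta))%:E * (t^-1)%:E))%E).
    by apply: lee_wpmul2l; [rewrite lee_fin ltW|exact: h].
  rewrite -!EFinM lee_fin.
  have -> : C * (w * (C * p `^ beta) * t^-1) = C * C * (w * p `^ beta / t) by ring.
  have -> : osc_factor * w * p `^ beta / t = osc_factor * (w * p `^ beta / t) by ring.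
  apply: ler_wpM2r; first by rewrite !mulr_ge0 ?invr_ge0 ?(ltW t0) ?(ltW w0).
  by rewrite /osc_factor -/C; lra.
have mh : measurable_fun setT ((fun x => f x - c) : mT -> R).
  by apply: measurable_funB => //; exact: measurable_cst.
(* The mesh is taken to be [w], so the bottom layer costs [w * p ^+ N]. *)
apply: (le_trans (integral_le_choquet b p0 w0 mh)).
apply: (@le_trans _ _ ((w * p ^+ N)%:E + (p `^ (N%:R - beta))%:E * (w * (C * p `^
  beta))%:E)%E).
  by rewrite leeD2l//; apply: lee_wpmul2l; rewrite ?lee_fin ?powR_ge0.
rewrite -EFinM -EFinD lee_fin.
have -> : p `^ (N%:R - beta) * (w * (C * p `^ beta)) = w * C * p ^+ N.
  have -> : p ^+ N = p `^ (N%:R - beta) * p `^ beta.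
    rewrite -powRD ?subrK ?powR_mulrn ?(ltW p0)//.
    by rewrite (gt_eqF p0) implybT.
  by ring.
have : 0 <= C * C * w * p ^+ N by rewrite !mulr_ge0 ?(ltW C0) ?(ltW w0) ?exprn_ge0 ?(ltW
  p0).
by rewrite /osc_factor -/C; lra.
Qed.

Hypothesis osc_fin : exists w : R, (mean_osc beta (fun x => (f x)%:E) (cube a l) <
  w%:E)%E.

Definition fintegral b p : R := fine (abs_integral b p).

(** On [cube a l] the function differs from a constant by an integrable one, and every other cube
    sees it only there. *)
Lemma abs_integral_fin b p : abs_integral b p = (fintegral b p)%:E.
Proof.
rewrite fineK// ge0_fin_numE ?abs_integral_ge0//.
apply: (@le_lt_trans _ _ (abs_integral a l)); first by apply: abs_integral_le => x [].
have [w ww] := osc_fin.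
have w1 : 0 < Num.max w 1 by rewrite lt_max ltr01 orbT.
have [|c [_ h]] := @small_osc a l _ w1 l0.
  by apply: (lt_le_trans ww); rewrite lee_fin le_max lexx.
by have [/le_lt_trans->//] := abs_integral_compare l0 (@subset_refl _ _) h; exact: ltry.
Qed.

Lemma fintegral_ge0 b p : 0 <= fintegral b p.
Proof. exact/fine_ge0/abs_integral_ge0. Qed.

Lemma fintegral_le b p b' p' :
  cube b p `&` cube a l `<=` cube b' p' -> fintegral b p <= fintegral b' p'.
Proof. by move=> h; rewrite -lee_fin -!abs_integral_fin; exact: abs_integral_le. Qed.

Lemma small_osc_controlled (w rho : R) : 0 < w ->
  (forall b p, 0 < p -> p <= rho -> cube b p `<=` cube a l ->
    (mean_osc beta (fun x => (f x)%:E) (cube b p) < w%:E)%E) ->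
  controlled_osc beta a l f fintegral (osc_factor * w) rho.
Proof.
move=> w0 h b p p0 prho ba; have [c [c1 c2]] := small_osc w0 p0 (h b p p0 prho ba).
exists c; split=> // b' p' p'0 sub.
have [] := abs_integral_compare p'0 sub c2.
by rewrite abs_integral_fin -EFinD !lee_fin.
Qed.

Lemma frac_maximalE alpha x : frac_maximal alpha f x = fmax alpha fintegral x.
Proof.
rewrite /frac_maximal /fmax; congr ereal_sup; apply/seteqP; split=> s.
  by move=> [b [p [p0 bx ->]]]; exists b, p; split=> //;
    rewrite -/(abs_integral b p) abs_integral_fin.
by move=> [b [p [p0 bx ->]]]; exists b, p; split=> //;
  rewrite -/(abs_integral b p) abs_integral_fin.
Qed.

End means.

(** * Oscillation, integrability and quasicontinuity of the fractional maximal function *)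

Section maximal_vmo.
Context {R : realType} {n : nat}.
Local Notation V := 'rV[R]_n.+1.
Local Notation N := n.+1.
Variables (alpha beta : R).
Hypothesis beta_gt0 : 0 < beta.
Hypothesis beta_le : beta <= N%:R.
Hypothesis alpha_ge0 : 0 <= alpha.
Hypothesis alpha_lt : alpha < beta.
Variables (a : V) (l : R).
Hypothesis l0 : 0 < l.
Variables (f : V -> R) (J : V -> R -> R).
Hypothesis J_ge0 : forall b p, 0 <= J b p.
Hypothesis J_le : forall b p b' p',
  cube b p `&` cube a l `<=` cube b' p' -> J b p <= J b' p'.
Local Notation F := (fmax alpha J).
Local Notation H := (gcontent beta a l).
Local Notation C := (@grid_const R n beta).

Let C0 : 0 < C. Proof. exact: grid_const_gt0. Qed.

Lemma hcontent_le E (z : R) : (H E <= z%:E)%E -> (hcontent beta E <= (C * z)%:E)%E.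
Proof.
move=> Ez; rewrite hcontentE;
  apply: (le_trans (gcontent_comparable beta_gt0 0 a _ ltr01 l0)).
by rewrite [leRHS]EFinM; apply: lee_wpmul2l => //; rewrite lee_fin ltW.
Qed.

Definition osc_bound (s w rho : R) : R :=
  osc_const (n := n) alpha beta l * w +
  N%:R * s / (rho / 2) * ((rho / 2) `^ (- (N%:R - alpha)) * J a l).

(** The competitor in the infimum is the constant [G] of [local_osc]. It lies below the maximal
    function, so the absolute value disappears and the level sets decay geometrically. *)
Lemma fmax_mean_osc (w rho s tau : R) b : 0 < w -> 0 < rho ->
  controlled_osc beta a l f J w rho -> 0 < s -> Num.min (6 * s) l <= rho ->
  cube b s `<=` cube a l -> 0 < tau -> osc_bound s w rho <= tau ->
  (mean_osc beta F (cube b s) <= ((C + 2 * (C * C)) * tau)%:E)%E.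
Proof.
move=> w0 rho0 osc s0 srho ba tau0 hb.
have [G [G0 FG decay]] := local_osc beta_gt0 beta_le alpha_ge0 alpha_lt l0 J_ge0 J_le
  w0 rho0 osc s0 srho ba hb.
have sb0 : 0 <= s `^ beta by exact: powR_ge0.
have [h hE /andP[_ hC]] := hcontent_cube beta_gt0 beta_le b s0.
apply: (@mean_osc_le _ _ _ beta_gt0 beta_le F b s G) => //.
  by rewrite mulr_ge0 ?(ltW tau0)// addr_ge0 ?mulr_ge0 ?(ltW C0).
apply: (le_trans (@choquet_geometric _ _ beta (cube b s) _ tau (C * s `^ beta)
    (C * C * s `^ beta) tau0 _ _ _)).
- by rewrite !mulr_ge0 ?(ltW C0).
- by rewrite hE lee_fin.
- move=> j; have -> : C * C * s `^ beta * 2^-1 ^+ j = C * (C * 2^-1 ^+ j * s `^ beta) by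
  ring.
  apply: le_trans (hcontent_le (decay j)); apply: le_cover_content => x [bx tx].
  split=> //; move: (FG x bx) tx; case: (F x) => [r|_ _|];
    [|exact: ltry|by rewrite leeNy_eq].
  rewrite /= lee_fin !lte_fin => Gr; rewrite ger0_norm ?subr_ge0// mulrC; lra.
by rewrite lee_fin le_eqVlt; apply/orP; left; apply/eqP; ring.
Qed.

Lemma fmax_choquet_fin (w : R) : 0 < w -> controlled_osc beta a l f J w l ->
  (choquet beta (cube a l) (fun x => `|F x|) < +oo)%E.
Proof.
move=> w0 osc; have ll : Num.min (6 * l) l <= l by rewrite ge_min lexx orbT.
have bound0 : 0 <= osc_bound l w l.
  rewrite addr_ge0// ?mulr_ge0 ?powR_ge0 ?invr_ge0 ?divr_ge0 ?(ltW w0) ?(ltW l0)//.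
  by rewrite addr_ge0 ?mulr_ge0 ?exprn_ge0 ?powR_ge0 ?(ltW (jn_const_gt0 _)).
have tau0 : 0 < osc_bound l w l + 1 by lra.
have [|G [G0 FG decay]] := local_osc beta_gt0 beta_le alpha_ge0 alpha_lt l0 J_ge0 J_le
  (tau := osc_bound l w l + 1) w0 l0 osc l0 ll (@subset_refl _ _).
  by rewrite -/(osc_bound l w l); lra.
set tau := osc_bound l w l + 1 in tau0 decay.
have sb0 : 0 <= l `^ beta by exact: powR_ge0.
have [h hE /andP[_ hC]] := hcontent_cube beta_gt0 beta_le a l0.
(* With mesh [tau + G] the level [j.+1%:R * (tau + G)] is at least [G + tau * j.+1%:R], so the decay
   applies without subtracting [G]. *)
have tG0 : 0 < tau + G by rewrite ltr_wpDr.
apply: (le_lt_trans (@choquet_geometric _ _ beta (cube a l) _ (tau + G) (C * l `^ beta)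
    (C * C * l `^ beta) tG0 _ _ _)); last exact: ltry.
- by rewrite !mulr_ge0 ?(ltW C0).
- by rewrite hE lee_fin.
move=> j; have -> : C * C * l `^ beta * 2^-1 ^+ j = C * (C * 2^-1 ^+ j * l `^ beta) by
  ring.
apply: le_trans (hcontent_le (decay j)); apply: le_cover_content => x [bx tx].
split=> //; move: (FG x bx) tx; case: (F x) => [r|_ _|];
  [|exact: ltry|by rewrite leeNy_eq].
rewrite /= lee_fin !lte_fin => Gr; rewrite ger0_norm; last exact: le_trans Gr.
have : 0 <= j%:R * G by rewrite mulr_ge0.
by rewrite -(natr1 j); lra.
Qed.

Hypothesis f_quasi : quasicontinuous beta (cube a l) (fun x => (f x)%:E).
Hypothesis f_osc : forall w : R, 0 < w -> exists2 rho : R, 0 < rho &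
  controlled_osc beta a l f J w rho.

Lemma fmax_quasicontinuous : quasicontinuous beta (cube a l) F.
Proof.
move=> e e0; have X0 : 0 < @exceptional_const R n beta.
  by rewrite /exceptional_const addr_gt0 ?mulr_gt0 ?powR_gt0.
(* One factor [C] for passing to the adapted grid, one for returning; the 2 makes the final
   inequality strict. *)
pose e1 := e / (2 * (C * C) * @exceptional_const R n beta).
have e10 : 0 < e1 by rewrite divr_gt0 ?mulr_gt0.
have [W [oW Wa HW _ cW]] := f_quasi e10.
have HW' : (H W < (C * e1)%:E)%E.
  rewrite [ltRHS]EFinM;
    apply: (le_lt_trans (gcontent_comparable beta_gt0 a 0 _ l0 ltr01)).
  by rewrite -hcontentE lte_pmul2l// lte_fin.
have Ce0 : 0 < C * e1 by rewrite mulr_gt0.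
have [U [oU WU Ua HU Uthin]] := exists_exceptional beta_gt0 l0 Ce0 oW Wa HW'.
have f_cont := within_continuous_close cW.
exists U; split=> //.
- apply: (le_lt_trans (hcontent_le HU)); rewrite lte_fin /e1.
  have -> : C * (@exceptional_const R n beta *
      (C * (e / (2 * (C * C) * @exceptional_const R n beta)))) = e / 2.
    by field; rewrite !gt_eqF.
  by lra.
- move=> x /set_mem Qx.
  exact: (fmax_fin beta_gt0 beta_le alpha_ge0 alpha_lt l0 J_ge0 J_le WU Uthin f_cont
    f_osc Qx).
rewrite continuous_subspace_in => x /set_mem Qx.
have fin y (Qy : (cube a l `\` U) y) : F y \is a fin_num.
  exact: (fmax_fin beta_gt0 beta_le alpha_ge0 alpha_lt l0 J_ge0 J_le WU Uthin f_cont
    f_osc Qy).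
rewrite /continuous_at /from_subspace/= -[in X in _ --> X](fineK (fin x Qx));
  apply/fine_cvgP; split.
  suff : within (cube a l `\` U) (nbhs x) [set y | F y \is a fin_num].
    by rewrite nbhs_subspace_in.
  by apply/nbhs_rowP; exists 1 => // y _; exact: fin.
apply/cvgrPdist_le => d d0.
suff : within (cube a l `\` U) (nbhs x) [set y | `|fine (F x) - fine (F y)| <= d].
  by rewrite nbhs_subspace_in.
have [r r0 rP] := fmax_close beta_gt0 beta_le alpha_ge0 alpha_lt l0 J_ge0 J_le WU Uthin
  f_cont f_osc Qx d0.
apply/nbhs_rowP; exists r => // y xy Qy /=; have := rP y Qy xy.
rewrite -(fineK (fin x Qx)) -(fineK (fin y Qy)) -EFinB -EFinD !lee_fin /=.
by rewrite ler_distlC.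
Qed.

End maximal_vmo.

(** * Oscillation bounds from the BMO and VMO conditions, and the conclusion for the maximal
    function *)

Section vmo_hypotheses.
Context {R : realType} {n : nat}.
Local Open Scope ereal_scope.
Variables (beta : R) (Q : set 'rV[R]_n.+1) (g : 'rV[R]_n.+1 -> \bar R).

Lemma bmo_mean_osc : bmo_norm beta Q g < +oo -> exists2 w : R, (0 < w)%R &
  forall b p, (0 < p)%R -> cube b p `<=` Q -> mean_osc beta g (cube b p) < w%:E.
Proof.
move=> gfin; have [w gw] : exists w : R, bmo_norm beta Q g <= w%:E.
  by case: (bmo_norm beta Q g) gfin => [r| |]// _; [exists r|exists 0%R; rewrite leNye].
exists (Num.max w 0 + 1)%R.
  by have : (0 <= Num.max w 0)%R; [rewrite le_max lexx orbT|lra].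
move=> b p p0 bQ; apply: (@le_lt_trans _ _ w%:E).
  by apply: le_trans gw; apply: ereal_sup_ubound; exists b, p.
rewrite lte_fin; have : (w <= Num.max w 0)%R by rewrite le_max lexx.
by lra.
Qed.

Lemma vmo_mean_osc : osc_modulus beta Q g r @[r --> 0^'+] --> 0 ->
  forall w : R, (0 < w)%R -> exists2 rho : R, (0 < rho)%R &
  forall b p, (0 < p)%R -> (p <= rho)%R -> cube b p `<=` Q ->
    mean_osc beta g (cube b p) < w%:E.
Proof.
move=> g0 w w0.
have near_w : \forall r \near 0^'+, osc_modulus beta Q g r < w%:E.
  by apply: (g0 [set z | z < w%:E]); exact: lt_nbhsl.
have rho_gt0 : \forall r \near (0 : R)^'+, (0 < r)%R by exact: nbhs_right_gt.
have [rho [rho_w rho0]] : exists rho : R, osc_modulus beta Q g rho < w%:E /\ (0 < rho)%R.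
  by apply: (@filter_ex _ ((0 : R)^'+)); exact: filterI.
exists rho => // b p p0 prho bQ; apply: le_lt_trans rho_w.
by apply: ereal_sup_ubound; exists b, p.
Qed.

Lemma mean_osc_ge0 (E : set 'rV[R]_n.+1) : 0 <= mean_osc beta g E.
Proof.
apply: le_ereal_inf_tmp => _ [c _ <-]; rewrite mule_ge0 ?choquet_ge0//.
by rewrite inve_ge0; apply: cover_content_ge0 => q; exact: powR_ge0.
Qed.

End vmo_hypotheses.

Theorem theorem1p5 (R : realType) (n : nat) (alpha beta : R)
    (hbeta : 0 < beta <= n.+1%:R) (halpha : 0 <= alpha < beta)
    (a0 : 'rV[R]_n.+1) (l0 : R) (hl0 : 0 < l0)
    (f : 'rV[R]_n.+1 -> R)
    (fVMO : VMO beta (cube a0 l0) (fun x => (f x)%:E))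
    (fsupp : forall x, f x != 0 -> cube a0 l0 x)
    (Mf_fin : ~ (forall x, frac_maximal alpha f x = +oo%E)) :
  VMO beta (cube a0 l0) (frac_maximal alpha f).
Proof.
have /andP[beta0 betaN] := hbeta; have /andP[alpha0 alphaB] := halpha.
have [[[fq _] fbmo] fvmo] := fVMO.
have mf := quasicontinuous_measurable beta0 betaN hl0 fsupp fq.
have [w1 w10 oscw1] := bmo_mean_osc fbmo.
have oscQ : exists w : R, (mean_osc beta (fun x => (f x)%:E) (cube a0 l0) < w%:E)%E.
  by exists w1; exact: oscw1.
set J := @fintegral R n f.
have J0 b p : 0 <= J b p by exact: fintegral_ge0.
have JL b p b' p' : cube b p `&` cube a0 l0 `<=` cube b' p' -> J b p <= J b' p'.
  by move=> sub; exact: (fintegral_le beta0 betaN hl0 fsupp mf oscQ sub).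
have -> : frac_maximal alpha f = fmax alpha J.
  by apply/funext => x; exact: (frac_maximalE beta0 betaN hl0 fsupp mf oscQ).
pose K := @osc_factor R n beta.
have K0 : 0 < K.
  by rewrite !addr_gt0// ?mulr_gt0// grid_const_gt0.
(* The BMO bound holds at every scale, so the admissible scale is the full side [l0]. *)
have osc_bmo : controlled_osc beta a0 l0 f J (K * w1) l0.
  apply: (small_osc_controlled beta0 betaN hl0 fsupp mf oscQ w10) => b p p0 _ ba.
  exact: oscw1.
have osc_vmo (w : R) : 0 < w -> exists2 rho : R, 0 < rho &
    controlled_osc beta a0 l0 f J w rho.
  move=> w0; have [|rho rho0 h] := vmo_mean_osc fvmo (w := w / K);
    first by rewrite divr_gt0.
  exists rho => //; rewrite -[w](divfK (lt0r_neq0 K0)) mulrC.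
  by apply: (small_osc_controlled beta0 betaN hl0 fsupp mf oscQ) => //; rewrite divr_gt0.
have Kw10 : 0 < K * w1 by rewrite mulr_gt0.
have C0 : 0 < @grid_const R n beta by exact: grid_const_gt0.
pose C1 := @grid_const R n beta + 2 * (@grid_const R n beta * @grid_const R n beta).
have C10 : 0 < C1 by rewrite addr_gt0 ?mulr_gt0.
have N0 : 0 < n.+1%:R :> R by rewrite ltr0n.
(* The coefficient of the side [s] in [osc_bound]: for fixed [rho] this term vanishes as [s] tends
   to 0. *)
pose B rho := n.+1%:R / (rho / 2) * ((rho / 2) `^ (- (n.+1%:R - alpha)) * J a0 l0).
have B0 rho : 0 < rho -> 0 <= B rho.
  by move=> r0; rewrite !mulr_ge0 ?invr_ge0 ?powR_ge0 ?divr_ge0 ?(ltW r0) ?(ltW N0).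
have boundE s w rho : osc_bound alpha beta a0 l0 J s w rho =
    osc_const (n := n) alpha beta l0 * w + s * B rho.
  by rewrite /osc_bound /B; congr (_ + _); ring.
have c0 : 0 <= osc_const (n := n) alpha beta l0.
  rewrite mulr_ge0 ?powR_ge0// addr_ge0// mulr_ge0 ?exprn_ge0 ?powR_ge0//.
  exact/ltW/jn_const_gt0.
split; first split; first split.
- exact: (fmax_quasicontinuous beta0 betaN alpha0 alphaB hl0 J0 JL fq osc_vmo).
- exact: (fmax_choquet_fin beta0 betaN alpha0 alphaB hl0 J0 JL Kw10 osc_bmo).
- pose tau := osc_const (n := n) alpha beta l0 * (K * w1) + l0 * B l0 + 1.
  have tau0 : 0 < tau.
    by rewrite ltr_wpDl// addr_ge0// mulr_ge0 ?(ltW Kw10) ?(ltW hl0) ?B0.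
  apply: (@le_lt_trans _ _ (C1 * tau)%:E); last exact: ltry.
  apply: ge_ereal_sup => _ [b [s [s0 ba ->]]].
  have sl := cube_sub_le s0 hl0 ba.
  apply: (fmax_mean_osc beta0 betaN alpha0 alphaB hl0 J0 JL Kw10 hl0 osc_bmo s0 _ ba
    tau0).
    by rewrite ge_min lexx orbT.
  rewrite boundE /tau; have : s * B l0 <= l0 * B l0 by rewrite ler_wpM2r ?B0.
  by lra.
have small e : 0 < e -> exists2 d : R, 0 < d & forall r, 0 < r -> r < d ->
    (0 <= osc_modulus beta (cube a0 l0) (fmax alpha J) r <= e%:E)%E.
  move=> e0; pose tau := e / C1; have tau0 : 0 < tau by rewrite divr_gt0.
  set c := osc_const alpha beta l0 in boundE c0.
  (* First [w], then [rho], then [d]: each of the two terms of [osc_bound] is brought below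
     [tau / 2]. *)
  pose w := tau / (2 * (c + 1)); have w0 : 0 < w by rewrite divr_gt0// mulr_gt0//; lra.
  have [rho rho0 osc] := osc_vmo w w0.
  have b0 : 0 <= B rho := B0 rho rho0.
  pose d := Num.min (rho / 6) (tau / (2 * (B rho + 1))).
  have d0 : 0 < d by rewrite lt_min !divr_gt0// mulr_gt0//; lra.
  have d1 : d <= rho / 6 by rewrite ge_min lexx.
  have d2 : d <= tau / (2 * (B rho + 1)) by rewrite ge_min lexx orbT.
  exists d => // r r0 rd; apply/andP; split.
    (* Nonnegativity of the supremum needs an admissible cube, the supremum of the empty set being
       [-oo]. *)
    pose s := Num.min r l0; have s0 : 0 < s by rewrite lt_min r0.
    apply: (@le_trans _ _ (mean_osc beta (fmax alpha J) (cube a0 s))).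
      exact: mean_osc_ge0.
    apply: ereal_sup_ubound; exists a0, s; split=> //; first by rewrite ge_min lexx.
    move=> x xa i; have /andP[-> /= h] := xa i; apply: (lt_le_trans h).
    by rewrite lerD2l ge_min lexx orbT.
  apply: ge_ereal_sup => _ [b [s [s0 sr ba ->]]].
  have -> : e = C1 * tau by rewrite /tau mulrC divfK// gt_eqF.
  apply: (fmax_mean_osc beta0 betaN alpha0 alphaB hl0 J0 JL w0 rho0 osc s0 _ ba tau0).
    by rewrite ge_min; apply/orP; left; lra.
  rewrite boundE.
  have h1 : c * w <= tau / 2.
    have -> : c * w = tau / 2 * (c / (c + 1)) by rewrite /w; field; rewrite gt_eqF//=;
      lra.
    by rewrite ger_pMr ?divr_gt0// ler_pdivrMr; lra.
  have h2 : s * B rho <= tau / 2.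
    apply: (@le_trans _ _ (tau / (2 * (B rho + 1)) * B rho));
      first by rewrite ler_wpM2r//; lra.
    have -> : tau / (2 * (B rho + 1)) * B rho = tau / 2 * (B rho / (B rho + 1)).
      by field; rewrite gt_eqF//=; lra.
    by rewrite ger_pMr ?divr_gt0// ler_pdivrMr; lra.
  by lra.
have near_small e : 0 < e -> \forall r \near 0^'+,
    (0 <= osc_modulus beta (cube a0 l0) (fmax alpha J) r <= e%:E)%E.
  move=> /small[d d0 dP]; near=> r; apply: dP; near: r.
    exact: nbhs_right_gt.
  exact: nbhs_right_lt.
apply/fine_cvgP; split.
  apply: filterS (near_small 1 ltr01) => r /andP[h1 h2].
  by rewrite ge0_fin_numE//; apply: le_lt_trans h2 _; exact: ltry.
apply/cvgrPdist_le => e /near_small; apply: filterS => r /andP[h1 h2] /=.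
rewrite sub0r normrN ger0_norm; last exact: fine_ge0.
have rfin : osc_modulus beta (cube a0 l0) (fmax alpha J) r \is a fin_num.
  by rewrite ge0_fin_numE//; apply: le_lt_trans h2 _; exact: ltry.
by rewrite -lee_fin fineK.
Unshelve. all: by end_near. Qed.
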